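(* Let $V:H\to H$ be a pure isometry with $\operatorname{codim}VH=m<\infty$, and let $S:H\to H$ be a bounded operator. Let $R:H\to H^2_m$ be the Kolmogorov--Wold representation of $V$. Then the following conditions are equivalent: (1) $S$ is a pure subnormal operator without point masses of finite type and the operators $S$ and $V$ commute; (2) $RSR^{-1}=T_F$ for some $m\times m$ matrix symbol $F$ of class $\mathrm{NDARN}_m$.
   Context: All Hilbert spaces are separable and complex, all operators are bounded and linear. $\mathbb{D}$ is the open unit disc, $\mathbb{T}$ the unit circle. An isometry $V:H\to H$ is pure if it has no non-zero invariant subspace $H_1\subset H$ such that $V|H_1$ is unitary. Vector Hardy space: for an integer $m\ge1$, $H^2_m=\{f(t)=\sum_{n\ge0}a_nt^n:\ a_n\in\mathbb{C}^m,\ \|f\|^2=\sum_n\|a_n\|^2<\infty\}$, a Hilbert space of $\mathbb{C}^m$-valued analytic functions on $\mathbb{D}$. A Kolmogorov--Wold representation of $V$ is a unitary operator $R:H\to H^2_m$ with $RVR^{-1}f(t)=tf(t)$ for $f\in H^2_m$; it exists if and only if $V$ is pure and $\dim(H\ominus VH)=m$. For a bounded analytic $m\times m$ matrix function $F$ on $\mathbb{D}$, $T_F$ is the analytic vector Toeplitz operator on $H^2_m$ given by $T_Fg(t)=F(t)g(t)$. Subnormal operators: $S\in\mathcal{L}(H)$ is subnormal if there are a Hilbert space $K\supset H$ and a normal operator $N\in\mathcal{L}(K)$ with $NH\subset H$ and $S=N|H$; $N$ is then called a normal extension of $S$. A subnormal $S$ is without point masses if it has a normal extension $N$ that has no non-zero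 eigenvectors. $S$ is pure if it has no nonzero invariant subspace on which it is normal. A subnormal operator is of finite type if it is pure and its self-commutator $S^*S-SS^*$ has finite rank. $\mathrm{NDARN}_m$ is the class of $m\times m$ matrix functions $F$ with rational entries that are (i) analytic: bounded and analytic on $\mathbb{D}$; (ii) normal: $F(t)$ is defined and normal for almost every $t\in\mathbb{T}$; (iii) non-degenerate: for every $c\in\mathbb{C}$, $\det(F(t)-cI)$ is not identically zero on $\mathbb{D}$. *)

(* Defs.v *)
From HB Require Import structures.
From mathcomp Require Import all_boot all_order all_algebra.
From mathcomp Require Import spectral complex.
From mathcomp Require Import all_classical all_reals all_analysis.

Set Implicit Arguments.
Unset Strict Implicit.
Unset Printing Implicit Defensive.

Import Order.TTheory GRing.Theory Num.Theory.
Import numFieldNormedType.Exports.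

Local Open Scope classical_set_scope.
Local Open Scope ring_scope.

(* Separable complex Hilbert spaces.  The norm of a normedModType R[i] takes
   its values in (the nonnegative reals of) R[i]. *)
HB.mixin Record CompleteNormedModule_isHilbert (R : realType) H
    & CompleteNormedModule R[i] H := {
  hdot : H -> H -> R[i];
  hdot_linearl : forall y, scalar (hdot ^~ y);
  hdotC : forall x y, hdot x y = (hdot y x)^*;
  hdot_norm : forall x, hdot x x = `|x| ^+ 2;
  hilbert_separable : exists2 D : set H, countable D & dense D
}.

#[short(type="hilbertType")]
HB.structure Definition Hilbert (R : realType) :=
  {H of CompleteNormedModule_isHilbert R H & CompleteNormedModule R[i] H}.

Section dimension.
Context {F : fieldType} {E : lmodType F}.

Definition lin_span (n : nat) (e : 'I_n -> E) : set E :=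
  [set x | exists c : 'I_n -> F, x = \sum_(i < n) c i *: e i].

Definition lin_free (n : nat) (e : 'I_n -> E) : Prop :=
  forall c : 'I_n -> F, \sum_(i < n) c i *: e i = 0 -> forall i, c i = 0.

Definition has_dim (A : set E) (n : nat) : Prop :=
  exists2 e : 'I_n -> E, lin_free e & lin_span e = A.

Definition finite_rank (T : E -> E) : Prop :=
  exists (n : nat) (e : 'I_n -> E), range T `<=` lin_span e.

End dimension.

Section operators.
Context {R : realType}.
Implicit Types H K : hilbertType R.

Definition bounded_op H K (T : {linear H -> K}) : Prop :=
  exists M : R[i], forall x, `|T x| <= M * `|x|.

Definition isometry_op H K (T : {linear H -> K}) : Prop :=
  forall x, `|T x| = `|x|.

Definition closed_subspace H (A : set H) : Prop :=
  [/\ A 0, forall (c : R[i]) x y, A x -> A y -> A (c *: x + y) & closed A].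

Definition invariant_subspace H (T : {linear H -> H}) (A : set H) : Prop :=
  closed_subspace A /\ T @` A `<=` A.

Definition orthocomp H (A : set H) : set H :=
  [set x | forall y, A y -> hdot x y = 0].

(* Hilbert-space codimension, dim (H \ominus A) for a closed subspace A. *)
Definition codim H (A : set H) (m : nat) : Prop := has_dim (orthocomp A) m.

(* T' is, on the invariant subspace A, the adjoint of the operator T|A of the
   Hilbert space A.  This determines T' on A, where it is automatically linear
   and bounded; its values outside A are irrelevant. *)
Definition adjoint_on H (A : set H) (T T' : H -> H) : Prop :=
  T' @` A `<=` A /\ forall x y, A x -> A y -> hdot (T x) y = hdot x (T' y).

Definition normal_on H (A : set H) (T : H -> H) : Prop :=
  exists2 T' : H -> H, adjoint_on A T T' &
    forall x, A x -> T (T' x) = T' (T x).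

Definition unitary_on H (A : set H) (T : H -> H) : Prop :=
  (forall x, A x -> `|T x| = `|x|) /\ T @` A = A.

Definition pure_isometry H (V : {linear H -> H}) : Prop :=
  isometry_op V /\
  forall A : set H, invariant_subspace V A -> unitary_on A V -> A `<=` [set 0].

(* The inclusion of H in K is an isometric embedding J. *)
Definition normal_extension H K (S : {linear H -> H}) (J : {linear H -> K})
    (N : {linear K -> K}) : Prop :=
  [/\ isometry_op J, bounded_op N, normal_on setT N &
      forall x, N (J x) = J (S x)].

Definition subnormal H (S : {linear H -> H}) : Prop :=
  exists (K : hilbertType R) (J : {linear H -> K}) (N : {linear K -> K}),
    normal_extension S J N.

Definition without_point_masses H (S : {linear H -> H}) : Prop :=
  exists (K : hilbertType R) (J : {linear H -> K}) (N : {linear K -> K}),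
    normal_extension S J N /\
    forall (c : R[i]) (x : K), N x = c *: x -> x = 0.

Definition pure_op H (S : {linear H -> H}) : Prop :=
  forall A : set H, invariant_subspace S A -> normal_on A S -> A `<=` [set 0].

Definition finite_rank_self_commutator H (S : {linear H -> H}) : Prop :=
  exists2 S' : H -> H, adjoint_on setT S S' &
    finite_rank (fun x => S' (S x) - S (S' x)).

Definition finite_type H (S : {linear H -> H}) : Prop :=
  [/\ subnormal S, pure_op S & finite_rank_self_commutator S].

End operators.

Section hardy.
Context {R : realType} (m : nat).

Definition disc : Type := {z : R[i] | `|z| < 1}.

(* f(t) = \sum_n a_n t^n on the disc, and s = \sum_n |a_n|^2.
   R[i]^o is R[i] with its topology; convergence in C^m is entrywise. *)
Definition h2_norm_sqr (f : disc -> 'cV[R[i]]_m) (s : R[i]) : Prop :=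
  exists2 a : nat -> 'cV[R[i]]_m,
    forall (t : disc) (j : 'I_m),
      series (fun n => a n j 0 * val t ^+ n : R[i]^o) @ \oo
        --> (f t j 0 : R[i]^o) &
    series (fun n => \sum_(j < m) `|a n j 0| ^+ 2 : R[i]^o) @ \oo
      --> (s : R[i]^o).

Definition H2 : set (disc -> 'cV[R[i]]_m) :=
  [set f | exists s, h2_norm_sqr f s].

(* U T U^-1; the partial inverse of U is a genuine inverse on H2 as soon as U
   maps H bijectively onto H2. *)
Definition conj_op (H : hilbertType R) (U : H -> (disc -> 'cV[R[i]]_m))
    (T : H -> H) : (disc -> 'cV[R[i]]_m) -> (disc -> 'cV[R[i]]_m) :=
  U \o T \o 'pinv_(fun=> 0) [set: H] U.

Record kolmogorov_wold (H : hilbertType R) (V : {linear H -> H})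
    (U : {linear H -> (disc -> 'cV[R[i]]_m)}) : Prop := KolmogorovWold {
  kw_bij : set_bij [set: H] H2 U;
  kw_isometry : forall x, h2_norm_sqr (U x) (`|x| ^+ 2);
  kw_shift : forall f, H2 f ->
    conj_op U V f = (fun t => val t *: f t)
}.

End hardy.

Arguments disc R : clear implicits.
Arguments H2 R m : clear implicits.

Section rational.
Context {R : realType}.
Implicit Types (f : {fraction {poly R[i]}}) (t : R[i]).

(* Numerator and denominator in lowest terms, unique up to a common constant
   factor. *)
Definition frac_num f : {poly R[i]} :=
  (repr f).1 %/ gcdp (repr f).1 (repr f).2.

Definition frac_den f : {poly R[i]} :=
  (repr f).2 %/ gcdp (repr f).1 (repr f).2.

(* t is not a pole of f. *)
Definition frac_defined f t : Prop := (frac_den f).[t] != 0.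

Definition frac_eval f t : R[i] := (frac_num f).[t] / (frac_den f).[t].

Lemma frac_evalE (p q : {poly R[i]}) t : q.[t] != 0 ->
  let f := FracField.tofrac p / FracField.tofrac q in
  frac_defined f t /\ frac_eval f t = p.[t] / q.[t].
Proof.
move=> qt0 f.
have q0 : q != 0 by apply: contraNneq qt0 => ->; rewrite horner0.
have defd : FracField.tofrac (repr f).1 = f * FracField.tofrac (repr f).2.
  rewrite -[X in _ = X * _]generic_quotient.reprK.
  rewrite [X in X = _]generic_quotient.piE [X in _ * X]generic_quotient.piE.
  rewrite -[RHS]FracField.pi_mul; apply/eqP.
  rewrite FracField.equivf_def /FracField.mulf.
  rewrite !numden_Ratio ?oner_eq0 ?mulf_neq0 ?denom_ratioP ?oner_eq0 //.
  by rewrite mulr1 mul1r mulrC.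
have nq : (repr f).1 * q = (repr f).2 * p.
  apply/eqP; rewrite -tofrac_eq !rmorphM /= defd /f mulrAC divfK 1?mulrC //.
  by rewrite tofrac_eq0.
have d0 : (repr f).2 != 0 by exact: denom_ratioP.
rewrite /frac_defined /frac_eval /frac_num /frac_den.
set n := (repr f).1 in nq *; set d := (repr f).2 in nq d0 *.
set g := gcdp n d.
have g0 : g != 0 by rewrite gcdp_eq0 negb_and d0 orbT.
have nq' : (n %/ g) * q = (d %/ g) * p.
  by apply: (mulIf g0); rewrite mulrAC divpK ?dvdp_gcdl// mulrAC divpK ?dvdp_gcdr.
have cop : coprimep (d %/ g) (n %/ g).
  by rewrite coprimep_sym; apply: coprimep_div_gcd; rewrite d0 orbT.
have dq : (d %/ g) %| q by rewrite -(Gauss_dvdpr _ cop) nq' dvdp_mulr.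
have dt0 : (d %/ g).[t] != 0.
  by apply: contraNneq qt0 => dt; rewrite -(divpK dq) hornerM dt mulr0.
split=> //; apply/eqP; rewrite eqr_div //; apply/eqP.
by have := congr1 (fun r => r.[t]) nq'; rewrite !hornerM [RHS]mulrC.
Qed.

End rational.

Section symbols.
Context {R : realType} (m : nat).
Implicit Type F : 'M[{fraction {poly R[i]}}]_m.

Definition mx_defined F (t : R[i]) : Prop :=
  forall i j, frac_defined (F i j) t.

Definition mx_eval F (t : R[i]) : 'M[R[i]]_m :=
  map_mx (frac_eval ^~ t) F.

Definition toeplitz F (g : disc R -> 'cV[R[i]]_m) : disc R -> 'cV[R[i]]_m :=
  fun t => mx_eval F (val t) *m g t.

(* mx_eval takes the junk value 0 at poles, whence the explicit mx_defined. *)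
Definition mx_analytic F : Prop :=
  (forall t : R[i], `|t| < 1 -> mx_defined F t /\
    forall i j, derivable (fun z : R[i]^o => frac_eval (F i j) z : R[i]^o) t 1)
  /\
  exists M : R[i], forall t : R[i], `|t| < 1 ->
    forall i j, `|mx_eval F t i j| <= M.

(* Almost everywhere for arc length on the unit circle, t = e^(ix). *)
Definition mx_normal F : Prop :=
  {ae lebesgue_measure, forall x : R, 0 <= x <= pi *+ 2 ->
    let t := Complex (cos x) (sin x) in
    mx_defined F t /\ mx_eval F t \is normalmx}.

Definition mx_nondegenerate F : Prop :=
  forall c : R[i], exists2 t : R[i], `|t| < 1 & \det (mx_eval F t - c%:M) != 0.

Definition NDARN F : Prop :=
  [/\ mx_analytic F, mx_normal F & mx_nondegenerate F].

End symbols.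

(* Main.v *)
Require Import Defs.
From HB Require Import structures.
From mathcomp Require Import all_boot all_order all_algebra.
From mathcomp Require Import spectral complex.
From mathcomp Require Import all_classical all_reals all_analysis.
From mathcomp Require Import ring lra.

(** Through the Wold representation [V] becomes multiplication by the variable
    on the Hardy space, and both conditions of the theorem amount to an identity
    [q(V) S = P(V)], with a polynomial [q] that has no zeros in the closed disc
    and a matrix polynomial [P] ([has_symbol]), such that the rational matrix
    function [P / q] is normal on the circle and non-degenerate
    ([normal_symbol]). Normality on the circle is expressed algebraically: if
    [P~] is the matrix polynomial equal to [t^d P(t)^*] on the circle
    ([mxrevconj]), it means that [P P~ = P~ P]. Below, [B] is the adjoint of
    [V] and the [u_j] are the constant functions given by the standard basis.

    From the operator to its symbol. A subnormal operator [S] with normal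
    extension [N] satisfies [|S^* x| <= |N^* x| = |S x|], and equality holds
    exactly on the kernel of the self-commutator [D] ([self_commutingP]). If
    [S] commutes with [V], this kernel is invariant under [V], and
    [S^* V = V S^*] on it ([self_commuting_shift]); hence it is orthogonal to
    all [B^(n+1) S u_j]. As [D] has finite rank, these vectors satisfy a linear
    relation modulo the kernel of [D], therefore a true one, and Kronecker's
    criterion shows that [S] has a rational symbol ([column_rational],
    [operator_rational]). Zeros of the denominator in the closed disc cancel,
    because [S] is defined on the whole space ([symbol_reduce]). The kernel of
    [D] contains a nonzero polynomial multiple of each [u_j], and there the
    equality of norms says that [P P~ - P~ P] vanishes ([symbol_normal]).
    Finally a degenerate symbol would give an eigenvector of [S], hence of [N]
    ([symbol_eigenvector]).

    From the symbol to the operator. Let [W] be the bilateral shift that extends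
    [V] ([bilateral_shift]) and [N = q(W)^-1 P(W)], an extension of [S]. The
    self-commutator of [N] vanishes on the range of [q~(W)], which is the whole
    space; so [N] is normal. It has no eigenvectors because
    [det (P - c q)(W)] is injective ([symbol_no_eigenvector]). The same
    computation for [V] shows that the self-commutator of [S] vanishes on the
    range of [q~(V)], which has finite codimension since the zeros of [q~] lie
    inside the disc ([symbol_finite_rank]). For purity, the largest subspace [A]
    on which [S] is normal is invariant under [V]. The constant term of the
    Cayley-Hamilton identity for [P / q] is a polynomial in [S] that kills the
    orthogonal complement of [V A] in [A]. A nonzero vector there would yield an
    eigenvector of [S], so that [A = V A], which forces [A = 0]
    ([wandering_eq0], [symbol_pure]).

    All the operators needed besides [V] and [S] are built from their action on
    Taylor coefficients, which identify [H] with the square-summable sequences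
    of vectors ([kolmogorov_wold_coefficients], [coef_operator]). *)

Set Implicit Arguments.
Unset Strict Implicit.
Unset Printing Implicit Defensive.

Import Order.TTheory GRing.Theory Num.Theory.
Import numFieldNormedType.Exports.

Local Open Scope classical_set_scope.
Local Open Scope ring_scope.

(** * Inner products, limits and projections *)

Section inner_product.
Context {R : realType}.
Local Notation C := R[i].
Implicit Types H K : hilbertType R.

Lemma hdotDl H (x y z : H) : hdot (x + y) z = hdot x z + hdot y z.
Proof. by have := hdot_linearl z 1 x y; rewrite scale1r mul1r. Qed.

Lemma hdot0l H (z : H) : hdot 0 z = 0.
Proof. by apply: (addrI (hdot 0 z)); rewrite -hdotDl !addr0. Qed.

Lemma hdotZl H (c : C) (x z : H) : hdot (c *: x) z = c * hdot x z.
Proof. by have := hdot_linearl z c x 0; rewrite addr0 hdot0l addr0. Qed.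

Lemma hdotNl H (x z : H) : hdot (- x) z = - hdot x z.
Proof. by rewrite -scaleN1r hdotZl mulN1r. Qed.

Lemma hdotBl H (x y z : H) : hdot (x - y) z = hdot x z - hdot y z.
Proof. by rewrite hdotDl hdotNl. Qed.

Lemma hdotDr H (x y z : H) : hdot z (x + y) = hdot z x + hdot z y.
Proof. by rewrite hdotC hdotDl rmorphD /= -!hdotC. Qed.

Lemma hdot0r H (z : H) : hdot z 0 = 0.
Proof. by rewrite hdotC hdot0l conjC0. Qed.

Lemma hdotZr H (c : C) (x z : H) : hdot z (c *: x) = c^* * hdot z x.
Proof. by rewrite hdotC hdotZl rmorphM /= -hdotC. Qed.

Lemma hdotNr H (x z : H) : hdot z (- x) = - hdot z x.
Proof. by rewrite hdotC hdotNl rmorphN /= -hdotC. Qed.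

Lemma hdotBr H (x y z : H) : hdot z (x - y) = hdot z x - hdot z y.
Proof. by rewrite hdotDr hdotNr. Qed.

Lemma hdot_suml H I (r : seq I) (P : pred I) (f : I -> H) z :
  hdot (\sum_(i <- r | P i) f i) z = \sum_(i <- r | P i) hdot (f i) z.
Proof.
by elim/big_rec2: _ => [|i y x _ <-]; rewrite ?hdot0l ?hdotDl.
Qed.

Lemma hdot_sumr H I (r : seq I) (P : pred I) (f : I -> H) z :
  hdot z (\sum_(i <- r | P i) f i) = \sum_(i <- r | P i) hdot z (f i).
Proof.
by elim/big_rec2: _ => [|i y x _ <-]; rewrite ?hdot0r ?hdotDr.
Qed.

Lemma hdotxx_eq0 H (x : H) : hdot x x = 0 -> x = 0.
Proof. by rewrite hdot_norm => /eqP; rewrite sqrf_eq0 normr_eq0 => /eqP. Qed.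

Lemma hdot_inj H (x y : H) : (forall z, hdot x z = hdot y z) -> x = y.
Proof.
by move=> xy; apply/subr0_eq/hdotxx_eq0; rewrite hdotBl xy subrr.
Qed.

Lemma hdot_injr H (x y : H) : (forall z, hdot z x = hdot z y) -> x = y.
Proof. by move=> xy; apply: hdot_inj => z; rewrite hdotC xy -hdotC. Qed.

Lemma hnormB_sqr H (x y : H) :
  `|x - y| ^+ 2 = `|x| ^+ 2 + `|y| ^+ 2 - (hdot x y + hdot y x).
Proof. rewrite -!hdot_norm !(hdotBl, hdotBr); ring. Qed.

Lemma hnormD_sqr H (x y : H) :
  `|x + y| ^+ 2 = `|x| ^+ 2 + `|y| ^+ 2 + (hdot x y + hdot y x).
Proof. rewrite -!hdot_norm !(hdotDl, hdotDr); ring. Qed.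

Lemma hnormD_orth H (x y : H) : hdot x y = 0 ->
  `|x + y| ^+ 2 = `|x| ^+ 2 + `|y| ^+ 2.
Proof. by move=> xy; rewrite hnormD_sqr (hdotC y) xy conjC0 !addr0. Qed.

(** Subtracting from [x] its component along [y] removes exactly the
    contribution [|<x,y>|^2 / |y|^2] of that component. *)
Lemma hnorm_residual H (x y : H) : y != 0 ->
  `|x - (hdot x y / `|y| ^+ 2) *: y| ^+ 2 =
  `|x| ^+ 2 - `|hdot x y| ^+ 2 / `|y| ^+ 2.
Proof.
move=> y0; have n0 : `|y| ^+ 2 != 0 by rewrite sqrf_eq0 normr_eq0.
have nc : (`|y| ^+ 2)^* = `|y| ^+ 2.
  by rewrite conj_Creal // rpredX // normr_real.
rewrite -[LHS]hdot_norm !(hdotBl, hdotBr) !(hdotZl, hdotZr) !hdot_norm.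
rewrite rmorphM /= fmorphV /= nc (hdotC y x) normCK.
by field; rewrite normr_eq0.
Qed.

Lemma cauchy_schwarz H (x y : H) : `|hdot x y| <= `|x| * `|y|.
Proof.
have [->|y0] := eqVneq y 0; first by rewrite hdot0r !normr0 mulr0.
have n0 : 0 < `|y| ^+ 2 by rewrite exprn_gt0 // normr_gt0.
rewrite -(@ler_pXn2r _ 2) ?nnegrE ?mulr_ge0 // exprMn -ler_pdivrMr //.
by rewrite -subr_ge0 -hnorm_residual // exprn_ge0.
Qed.

Lemma hdot_polarization H (x y : H) : 4 * hdot x y =
  `|x + y| ^+ 2 - `|x - y| ^+ 2 +
  'i * (`|x + 'i *: y| ^+ 2 - `|x - 'i *: y| ^+ 2).
Proof.
have ii : 'i * 'i = -1 :> C by rewrite -expr2 sqrCi.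
rewrite !hnormB_sqr !hnormD_sqr !hdotZl !hdotZr conjCi.
transitivity (2 * (1 - 'i * 'i) * hdot x y + 2 * (1 + 'i * 'i) * hdot y x).
  by rewrite ii; ring.
ring.
Qed.

Lemma hdot_polar H (x y : H) : let N c := `|x + c *: y| ^+ 2 in
  4 * hdot x y = N 1 - N (- 1) + 'i * (N 'i - N (- 'i)).
Proof. by rewrite /= hdot_polarization !scaleNr !scale1r. Qed.

(** By polarization, within the subspace. *)
Lemma eq_norm_hdot H K1 K2 (T1 : {linear H -> K1}) (T2 : {linear H -> K2})
    (X : set H) :
  (forall (c : C) x y, X x -> X y -> X (c *: x + y)) ->
  (forall x, X x -> `|T1 x| = `|T2 x|) ->
  forall x y, X x -> X y -> hdot (T1 x) (T1 y) = hdot (T2 x) (T2 y).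
Proof.
move=> linX eqT x y Xx Xy; apply: (@mulfI _ 4); first by rewrite pnatr_eq0.
have X' c : X (x + c *: y) by rewrite addrC; apply: linX.
have eqX c : `|T1 x + c *: T1 y| = `|T2 x + c *: T2 y|.
  by rewrite -!linearZ -!linearD; exact: eqT.
rewrite !hdot_polarization.
have := eqX 1; have := eqX (-1); have := eqX 'i; have := eqX (- 'i).
by rewrite !scaleN1r !scaleNr !scale1r => -> -> -> ->.
Qed.

Lemma isometry_hdot H K (T : {linear H -> K}) : isometry_op T ->
  forall x y, hdot (T x) (T y) = hdot x y.
Proof.
move=> isoT x y.
by apply: (@eq_norm_hdot _ _ _ T idfun setT).
Qed.

Lemma isometry_inj H K (T : {linear H -> K}) : isometry_op T -> injective T.
Proof.
move=> isoT x y Txy; apply/subr0_eq/normr0_eq0.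
by rewrite -isoT linearB Txy subrr normr0.
Qed.

Lemma bounded_op_nonneg H K (T : {linear H -> K}) : bounded_op T ->
  exists2 M : C, 0 <= M & forall x, `|T x| <= M * `|x|.
Proof.
move=> [M TM]; exists `|M| => // x.
have M0 : 0 <= M * `|x| by exact: le_trans (TM x).
by rewrite -[`|x|]normr_id -normrM ger0_norm.
Qed.

(** The factor [M] absorbs the constants of the estimates that lead to [x = 0]. *)
Lemma norm_small_eq0 (E : normedZmodType C) (x : E) (M : C) : 0 <= M ->
  (forall e : C, 0 < e -> `|x| <= M * e) -> x = 0.
Proof.
move=> M0 xe; apply/normr0_eq0/eqP; rewrite eq_le normr_ge0 andbT.
have [->|xn0] := eqVneq x 0; first by rewrite normr0.
have x0 : 0 < `|x| by rewrite normr_gt0.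
have M1 : 0 < 1 + M by rewrite ltr_pwDl.
have := xe (`|x| / (1 + M)); rewrite divr_gt0 // => /(_ isT).
by rewrite mulrA ler_pdivlMr // mulrDr mulr1 (mulrC M) gerDr.
Qed.

Lemma complex_ge0P (z : C) : 0 <= z -> exists2 r : R, 0 <= r & z = r%:C%C.
Proof.
move=> z0; exists (complex.Re z); last by rewrite RRe_real // ger0_real.
by move: z0; rewrite lecE => /andP[].
Qed.

Lemma complex_gt0P (z : C) : 0 < z -> exists2 r : R, 0 < r & z = r%:C%C.
Proof.
move=> z0; have [r _ zE] := complex_ge0P (ltW z0); exists r => //.
by rewrite -ltcR -zE.
Qed.

Lemma expr_lt1_small (q e : C) : 0 <= q < 1 -> 0 < e -> exists n, q ^+ n < e.
Proof.
move=> /andP[/complex_ge0P[r r0 ->]] + /complex_gt0P[s s0 ->].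
rewrite -[1]/(1%:C%C) ltcR => r1.
have /cvgrPdist_lt/(_ _ s0)[n _ /(_ n (leqnn _))] :
    (GRing.exp r : R^nat) @ \oo --> 0.
  by apply: cvg_expr; rewrite ger0_norm.
rewrite sub0r normrN ger0_norm ?exprn_ge0 // => rn.
by exists n; rewrite -rmorphXn ltcR.
Qed.

Lemma complete_limit H (u : nat -> H) (e : nat -> C) :
  (forall n k, (n <= k)%N -> `|u n - u k| <= e n) ->
  (forall eps : C, 0 < eps -> exists n, e n <= eps) ->
  exists l, forall n, `|u n - l| <= e n.
Proof.
move=> ue e0.
have /cvg_ex[l ul] : cvg (u @ \oo).
  apply/cauchy_cvgP; apply: cauchy_exP => eps eps0.
  have [n en] := e0 _ (divr_gt0 eps0 (ltr0n _ 2)).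
  exists (u n); exists n => // k /= nk; rewrite -ball_normE /=.
  apply: le_lt_trans (ue _ _ nk) _; apply: le_lt_trans en _.
  by rewrite gtr_pMr // invf_lt1 // ltr1n.
exists l => n.
have en_real : e n \is Num.real.
  by rewrite realE (le_trans _ (ue n n (leqnn n))).
rewrite real_leNgt ?normr_real //; apply/negP => lt_en.
have d0 : 0 < `|u n - l| - e n by rewrite subr_gt0.
have /cvgrPdist_lt/(_ _ d0)[k _ uk] := ul.
have := uk (maxn n k) (leq_maxr _ _); have := ue n _ (leq_maxl n k).
set v := u (maxn n k) => h1 h2.
have := ler_distD v (u n) l; apply/negP.
rewrite -real_ltNge ?normr_real ?realD ?normr_real //.
rewrite (distrC v l); apply: le_lt_trans (lerD h1 (lexx _)) _.
by rewrite addrC -ltrBrDr.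
Qed.

(** Points of the subspace that nearly minimise the distance to [x] form a
    Cauchy sequence, by the parallelogram identity. *)
Lemma orthogonal_projection H (A : set H) (x : H) : A 0 ->
  (forall (c : C) y z, A y -> A z -> A (c *: y + z)) ->
  (forall (u : nat -> H) l, (forall n, A (u n)) ->
     (forall eps : C, 0 < eps -> exists n, `|u n - l| <= eps) -> A l) ->
  exists2 p, A p & forall y, A y -> hdot (x - p) y = 0.
Proof.
move=> A0 linA closedA.
pose N (y : H) : R := complex.Re (`|x - y| ^+ 2).
have NE y : `|x - y| ^+ 2 = (N y)%:C%C.
  by rewrite RRe_real // rpredX // normr_real.
have N0 y : 0 <= N y by rewrite -lecR -NE exprn_ge0.
pose D := [set N y | y in A].
have infD : has_inf D.
  by split; [exists (N 0), 0 | exists 0 => _ [y _ <-]].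
pose d := inf D.
have dN y : A y -> d <= N y by move=> Ay; apply: ge_inf => //; [exact: infD.2|exists y].
have /choice[u uP] n : exists y, A y /\ N y < d + (4 ^- n).
  have e4 : 0 < 4 ^- n :> R by rewrite invr_gt0 exprn_gt0.
  by have [_ [y Ay <-] yd] := inf_adherent e4 infD; exists y.
have Au n : A (u n) by have [] := uP n.
have Acomb (c1 c2 : C) y z : A y -> A z -> A (c1 *: y + c2 *: z).
  by move=> Ay Az; apply: (linA) => //; rewrite -[_ *: _]addr0; apply: (linA).
have udist n k : (n <= k)%N -> `|u n - u k| <= (2 / 2 ^+ n : C).
  move=> nk; rewrite -(@ler_pXn2r _ 2) ?nnegrE ?divr_ge0 ?exprn_ge0 //.
  have par : `|u n - u k| ^+ 2 = 2 * `|x - u n| ^+ 2 + 2 * `|x - u k| ^+ 2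
      - 4 * `|x - (2^-1 *: u n + 2^-1 *: u k)| ^+ 2.
    rewrite -!hdot_norm !(hdotBl, hdotBr, hdotDl, hdotDr, hdotZl, hdotZr).
    by rewrite !fmorphV /= conjC_nat; field.
  have h3 : d <= N (2^-1 *: u n + 2^-1 *: u k) by apply/dN/Acomb.
  move: h3 par; set v := _ *: _ + _ => h3 ->; rewrite !NE.
  have -> : (2 / 2 ^+ n : C) ^+ 2 = (4 * 4 ^- n)%:C%C.
    rewrite rmorphM /= fmorphV rmorphXn /= !rmorph_nat.
    by rewrite expr_div_n -exprM mulnC exprM -natrX.
  have e2 : 2 = (2 : R)%:C%C by rewrite rmorph_nat.
  have e4 : 4 = (4 : R)%:C%C by rewrite rmorph_nat.
  rewrite e2 e4 -!rmorphM -rmorphD -rmorphB lecR.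
  have [_ h1] := uP n; have [_ h2] := uP k.
  have h4 : 4 ^- k <= 4 ^- n :> R.
    by rewrite lef_pV2 ?posrE ?exprn_gt0 // ler_weXn2l // ler1n.
  lra.
have half : (0 : C) <= (2^-1 : C) < 1.
  by apply/andP; split; [rewrite invr_ge0|rewrite invf_lt1 ?ltr1n].
have [eps eps0|p up] := complete_limit udist.
  have [n ne] := expr_lt1_small half (divr_gt0 eps0 (ltr0n _ 2)).
  by exists n; rewrite -exprVn mulrC -ler_pdivlMr // ltW.
have Ap : A p.
  apply: closedA Au _ => eps eps0.
  have [n ne] := expr_lt1_small half (divr_gt0 eps0 (ltr0n _ 2)).
  exists n; apply: le_trans (up n) _.
  by rewrite -exprVn mulrC -ler_pdivlMr // ltW.
exists p => // y Ay.
have [->|y0] := eqVneq y 0; first by rewrite hdot0r.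
have yp : 0 < `|y| by rewrite normr_gt0.
have un n : `|hdot (x - u n) y| <= 2 ^- n * `|y|.
  set w := x - u n; pose c := hdot w y / `|y| ^+ 2.
  have Auc : A (u n + c *: y) by rewrite addrC; exact: linA.
  have := hnorm_residual w y0; rewrite -/c -addrA -opprD !NE => E.
  have [_ ud] := uP n; have du := dN _ Auc.
  rewrite -(@ler_pXn2r _ 2) ?nnegrE ?mulr_ge0 ?invr_ge0 ?exprn_ge0 //.
  rewrite exprMn -ler_pdivrMr ?exprn_gt0 //.
  have -> : `|hdot w y| ^+ 2 / `|y| ^+ 2 = (N (u n) - N (u n + c *: y))%:C%C.
    by rewrite rmorphB /= E; ring.
  have -> : (2 ^- n : C) ^+ 2 = (4 ^- n)%:C%C.
    rewrite fmorphV rmorphXn /= rmorph_nat.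
    by rewrite exprVn -exprM mulnC exprM -natrX.
  by rewrite lecR; lra.
apply: (@norm_small_eq0 C^o _ (3 * `|y|)); first by rewrite mulr_ge0.
move=> eps eps0; have [n ne] := expr_lt1_small half eps0.
have -> : hdot (x - p) y = hdot (x - u n) y + hdot (u n - p) y.
  by rewrite -hdotDl addrA subrK.
apply: le_trans (ler_normD _ _) _.
apply: le_trans (lerD (un n) (cauchy_schwarz _ _)) _.
apply: le_trans (lerD (lexx _) (ler_wpM2r _ (up n))) _ => //.
rewrite -mulrDl (_ : _ + _ = 3 * 2 ^- n); last by ring.
rewrite mulrAC ler_wpM2l ?mulr_ge0 //.
by rewrite -exprVn ltW.
Qed.

End inner_product.

(** * Polynomials in an operator *)

Section operator_polynomials.
Context {K : fieldType} {E : lmodType K}.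
Implicit Types (T X : {linear E -> E}) (p q : {poly K}).

Lemma iter_linear T n (c : K) x y :
  iter n T (c *: x + y) = c *: iter n T x + iter n T y.
Proof. by elim: n => //= n ->; rewrite linearP. Qed.

Lemma iterB T n x y : iter n T (x - y) = iter n T x - iter n T y.
Proof. by elim: n => //= n ->; rewrite linearB. Qed.

Lemma iter0 T n : iter n T 0 = 0.
Proof. by elim: n => //= n ->; rewrite linear0. Qed.

Lemma iterZ T n (c : K) x : iter n T (c *: x) = c *: iter n T x.
Proof. by rewrite -[c *: x]addr0 iter_linear iter0 addr0. Qed.

Lemma iter_sum T n I (r : seq I) (P : pred I) (F : I -> E) :
  iter n T (\sum_(i <- r | P i) F i) = \sum_(i <- r | P i) iter n T (F i).
Proof.
elim/big_rec2: _ => [|i y z _ <-]; first exact: iter0.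
by rewrite -[F i]scale1r iter_linear !scale1r.
Qed.

Lemma iter_comm T X : (forall x, X (T x) = T (X x)) ->
  forall n x, X (iter n T x) = iter n T (X x).
Proof. by move=> XT; elim=> //= n IHn x; rewrite XT IHn. Qed.

Definition opoly T p (x : E) : E := \sum_(i < size p) p`_i *: iter i T x.

Lemma opoly_is_linear T p : linear (opoly T p).
Proof.
move=> c x y; rewrite /opoly scaler_sumr -big_split /=; apply: eq_bigr => i _.
by rewrite iter_linear scalerDr !scalerA mulrC.
Qed.

HB.instance Definition _ T p :=
  GRing.isLinear.Build K E E *:%R (opoly T p) (opoly_is_linear T p).

Lemma opoly_widen T p n x : (size p <= n)%N ->
  opoly T p x = \sum_(i < n) p`_i *: iter i T x.
Proof.
move=> pn; rewrite /opoly.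
rewrite -(big_mkord xpredT (fun i => p`_i *: iter i T x)).
rewrite -(big_mkord xpredT (fun i => p`_i *: iter i T x)).
rewrite [RHS](big_cat_nat _ pn) //= [X in _ + X]big1_seq ?addr0 // => i.
by rewrite mem_index_iota => /andP[_ /andP[pi _]]; rewrite nth_default ?scale0r.
Qed.

Lemma opoly_comb T (c : K) p q x :
  opoly T (c *: p + q) x = c *: opoly T p x + opoly T q x.
Proof.
pose n := maxn (size (c *: p + q)) (maxn (size p) (size q)).
rewrite !(@opoly_widen _ _ n) ?leq_max ?leqnn ?orbT //.
rewrite scaler_sumr -big_split /=; apply: eq_bigr => i _.
by rewrite coefD coefZ scalerDl scalerA.
Qed.

Lemma opolyD T p q x : opoly T (p + q) x = opoly T p x + opoly T q x.
Proof. by rewrite -{1}[p]scale1r opoly_comb scale1r. Qed.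

Lemma opoly0 T x : opoly T 0 x = 0.
Proof. by rewrite /opoly size_poly0 big_ord0. Qed.

Lemma opolyZ T (c : K) p x : opoly T (c *: p) x = c *: opoly T p x.
Proof. by rewrite -[c *: p]addr0 opoly_comb opoly0 addr0. Qed.

Lemma opolyB T p q x : opoly T (p - q) x = opoly T p x - opoly T q x.
Proof. by rewrite opolyD -[- q]scaleN1r opolyZ scaleN1r. Qed.

Lemma opolyC T (c : K) x : opoly T c%:P x = c *: x.
Proof.
by rewrite (@opoly_widen _ _ 1) ?size_polyC ?leq_b1 // big_ord1 coefC.
Qed.

Lemma opoly_sum T I (r : seq I) (P : pred I) (F : I -> {poly K}) x :
  opoly T (\sum_(i <- r | P i) F i) x = \sum_(i <- r | P i) opoly T (F i) x.
Proof.
by elim/big_rec2: _ => [|i y z _ <-]; rewrite ?opoly0 ?opolyD.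
Qed.

Lemma opoly_comm T X : (forall x, X (T x) = T (X x)) ->
  forall p x, X (opoly T p x) = opoly T p (X x).
Proof.
move=> XT p x; rewrite linear_sum /=; apply: eq_bigr => i _.
by rewrite linearZ /= iter_comm.
Qed.

Lemma opolyMX T p x : opoly T (p * 'X) x = T (opoly T p x).
Proof.
rewrite (@opoly_widen _ _ (size p).+1); last first.
  by apply: leq_trans (size_polyMleq _ _) _; rewrite size_polyX addn2.
rewrite big_ord_recl coefMX scale0r add0r linear_sum /=.
by apply: eq_bigr => i _; rewrite coefMX /= linearZ.
Qed.

Lemma opolyM T p q x : opoly T (p * q) x = opoly T p (opoly T q x).
Proof.
elim/poly_ind: p => [|p c IHp]; first by rewrite mul0r !opoly0.
rewrite mulrDl !opolyD mul_polyC opolyZ opolyC mulrAC !opolyMX.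
by congr (T _ + _).
Qed.

Lemma opoly_Xsub T (c : K) x : opoly T ('X - c%:P) x = T x - c *: x.
Proof. by rewrite opolyB opolyC -['X]mul1r opolyMX opolyC scale1r. Qed.

Lemma opolyXn T n x : opoly T 'X^n x = iter n T x.
Proof.
elim: n => [|n IHn]; first by rewrite expr0 opolyC scale1r.
by rewrite exprSr opolyMX IHn.
Qed.

End operator_polynomials.

Section matrix_polynomials.
Context {K : fieldType} {E : lmodType K} {m : nat}.
Context (T : {linear E -> E}) (e : 'I_m -> 'I_m -> {linear E -> E}).
Hypothesis emul : forall i j k l x, e i j (e k l x) = e i l x *+ (j == k).
Hypothesis eone : forall x, \sum_i e i i x = x.
Hypothesis ecomm : forall i j x, e i j (T x) = T (e i j x).

(** [mxop T e P] is [\sum_(i, j) p_ij(T) e_ij], the operator of multiplication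
    by the matrix polynomial [P = (p_ij)] when [T] is multiplication by the
    variable and the [e_ij] are the matrix units. *)
Definition mxop (P : 'M[{poly K}]_m) (x : E) : E :=
  \sum_i \sum_j opoly T (P i j) (e i j x).

Lemma mxop_is_linear P : linear (mxop P).
Proof.
move=> c x y; rewrite /mxop scaler_sumr -big_split /=; apply: eq_bigr => i _.
rewrite scaler_sumr -big_split /=; apply: eq_bigr => j _.
by rewrite linearP /= linearP.
Qed.

HB.instance Definition _ P :=
  GRing.isLinear.Build K E E *:%R (mxop P) (mxop_is_linear P).

Lemma mxopM P Q x : mxop (P *m Q) x = mxop P (mxop Q x).
Proof.
rewrite /mxop; apply: eq_bigr => i _.
under eq_bigr => j _ do rewrite mxE opoly_sum.
rewrite exchange_big /=; apply: eq_bigr => k _.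
rewrite linear_sum /= linear_sum /=.
under eq_bigr => l _ do rewrite opolyM.
under [RHS]eq_bigr => l _.
  rewrite linear_sum /= linear_sum /=.
  under eq_bigr => j _ do rewrite (opoly_comm (ecomm i k)) emul.
  over.
rewrite [RHS]exchange_big /=; apply: eq_bigr => j _.
rewrite (bigD1 k) //= eqxx mulr1n big1 ?addr0 // => l lk.
by rewrite eq_sym (negbTE lk) mulr0n !linear0.
Qed.

Lemma mxop_scalar p x : mxop p%:M x = opoly T p x.
Proof.
rewrite -{2}[x]eone linear_sum /=; apply: eq_bigr => i _.
rewrite (bigD1 i) //= mxE eqxx mulr1n big1 ?addr0 // => j ji.
by rewrite mxE eq_sym (negbTE ji) opoly0.
Qed.

Lemma mxopD P Q x : mxop (P + Q) x = mxop P x + mxop Q x.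
Proof.
rewrite /mxop -big_split /=; apply: eq_bigr => i _.
by rewrite -big_split /=; apply: eq_bigr => j _; rewrite mxE opolyD.
Qed.

Lemma mxop0 x : mxop 0 x = 0.
Proof. by rewrite /mxop big1 // => i _; rewrite big1 // => j _; rewrite mxE opoly0. Qed.

Lemma mxopB P Q x : mxop (P - Q) x = mxop P x - mxop Q x.
Proof. by apply: (addIr (mxop Q x)); rewrite -mxopD !subrK. Qed.

Lemma mxop_shift P x : mxop P (T x) = T (mxop P x).
Proof.
rewrite linear_sum /=; apply: eq_bigr => i _.
rewrite linear_sum /=; apply: eq_bigr => j _.
by rewrite ecomm (opoly_comm (X := T)).
Qed.

Lemma mxop_opoly P p x : mxop P (opoly T p x) = opoly T p (mxop P x).
Proof. exact: (opoly_comm (mxop_shift P)). Qed.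

End matrix_polynomials.

(** * Inverting polynomials in a contraction *)

Section inverses.
Context {R : realType}.
Local Notation C := R[i].
Implicit Types H : hilbertType R.

Definition contraction_op H (T : {linear H -> H}) : Prop :=
  forall x, `|T x| <= `|x|.

Definition bounded_inverse H (X : H -> H) (G : {linear H -> H}) : Prop :=
  [/\ bounded_op G, forall x, X (G x) = x & forall x, G (X x) = x].

Lemma bounded_opM H (X Y : {linear H -> H}) :
  bounded_op X -> bounded_op Y -> bounded_op (X \o Y).
Proof.
move=> /bounded_op_nonneg[a a0 Xa] /bounded_op_nonneg[b b0 Yb].
exists (a * b) => x /=; apply: le_trans (Xa _) _.
by rewrite -mulrA ler_wpM2l.
Qed.

Lemma bounded_below_inverse H (X : {linear H -> H}) (M : C) :
  (forall y, `|y| <= M * `|X y|) -> (forall x, exists y, X y = x) ->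
  exists G, bounded_inverse X G.
Proof.
move=> XM /choice[g gX].
have Xinj : injective X.
  move=> x y Xxy; apply/subr0_eq/normr0_eq0/le_anti.
  by rewrite normr_ge0 andbT (le_trans (XM _)) // linearB Xxy subrr normr0 mulr0.
have lin_g : linear g by move=> c x y; apply: Xinj; rewrite gX linearP !gX.
pose G : {linear H -> H} := HB.pack g (GRing.isLinear.Build C H H *:%R g lin_g).
exists G; split=> [|x|x]; [|exact: gX|by apply: Xinj; rewrite gX].
by exists M => x; rewrite -{2}[x]gX.
Qed.

(** The Neumann series of [(1 - c T)^-1], summed by the iteration
    [y := x + c T y]. *)
Lemma neumann H (T : {linear H -> H}) (c : C) :
  contraction_op T -> `|c| < 1 -> forall x, exists y, y - c *: T y = x.
Proof.
move=> T1 c1 x; have d0 : 0 < 1 - `|c| by rewrite subr_gt0.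
pose u n := iter n (fun y => x + c *: T y) 0.
have cT y : `|c *: T y| <= `|c| * `|y| by rewrite normrZ ler_wpM2l.
have un n : `|u n| <= `|x| / (1 - `|c|).
  elim: n => [|n IHn]; first by rewrite normr0 divr_ge0 // ltW.
  apply: le_trans (ler_normD _ _) _.
  apply: le_trans (lerD (lexx _) (le_trans (cT _) (ler_wpM2l _ IHn))) _ => //.
  by rewrite le_eqVlt; apply/orP; left; apply/eqP; field; rewrite gt_eqF.
have ud n k : `|u n - u (n + k)%N| <= `|c| ^+ n * `|u k|.
  elim: n => [|n IHn]; first by rewrite sub0r normrN expr0 mul1r.
  rewrite addSn /= opprD addrACA subrr add0r -scalerBr -linearB.
  by apply: le_trans (cT _) _; rewrite exprS -mulrA ler_wpM2l.
set D := `|x| / (1 - `|c|) in un; have D0 : 0 <= D by exact: le_trans (un 0%N).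
have small eps : 0 < eps -> exists n, `|c| ^+ n * D <= eps.
  move=> e0; have D1 : 0 < 1 + D by rewrite ltr_pwDl.
  have [||n ne] := @expr_lt1_small _ `|c| (eps / (1 + D)).
  - by rewrite normr_ge0.
  - by rewrite divr_gt0.
  exists n; move: ne; rewrite ltr_pdivlMr // => /ltW; apply: le_trans.
  by rewrite ler_wpM2l ?exprn_ge0 // lerDr.
have [n k nk||y uy] := @complete_limit _ _ u (fun n => `|c| ^+ n * D).
- rewrite -(subnKC nk); apply: le_trans (ud _ _) _.
  by rewrite ler_wpM2l ?exprn_ge0.
- by move=> eps /small[n ne]; exists n.
exists y; apply/eqP; rewrite subr_eq -subr_eq0; apply/eqP.
apply: (@norm_small_eq0 _ _ _ 2) => // eps /small[n ne].
have -> : y - (x + c *: T y) = (y - u n.+1) + c *: T (u n - y).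
  rewrite -[u n.+1]/(x + c *: T (u n)) linearB scalerBr addrA !opprD !addrA.
  by rewrite subrK.
apply: le_trans (ler_normD _ _) _; rewrite mulr_natl mulr2n.
apply: lerD.
  rewrite distrC; apply: le_trans (uy _) (le_trans _ ne).
  by rewrite exprS -mulrA ler_piMl ?(ltW c1) // mulr_ge0 ?exprn_ge0.
apply: le_trans (cT _) _; apply: le_trans (le_trans (uy n) ne).
by rewrite ler_piMl // ltW.
Qed.

(** The polynomials that are invertible in the algebra of rational functions
    bounded on the disc. *)
Definition disc_unit (q : {poly C}) : Prop := forall z, `|z| <= 1 -> q.[z] != 0.

Lemma disc_unit_neq0 q : disc_unit q -> q != 0.
Proof.
move=> q1; have := q1 0; rewrite normr0 ler01 => /(_ isT).
by apply: contraNneq => ->; rewrite horner0.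
Qed.

Lemma disc_unit_factor q : disc_unit q ->
  exists r, q = lead_coef q *: \prod_(z <- r) ('X - z%:P) /\
    forall z, z \in r -> 1 < `|z|.
Proof.
move=> q1; have [r qE] := closed_field_poly_normal q; exists r; split=> // z zr.
rewrite real_ltNge ?normr_real //; apply/negP => z1.
have /negP := q1 _ z1; apply; rewrite qE hornerZ.
by rewrite (eqP (_ : root _ z)) ?root_prod_XsubC // mulr0.
Qed.

(** Each factor [T - z] with [|z| > 1] is bounded below and onto, by the
    Neumann series of [1 - T / z]. *)
Lemma opoly_inverse H (T : {linear H -> H}) (q : {poly C}) :
  contraction_op T -> disc_unit q -> exists G, bounded_inverse (opoly T q) G.
Proof.
move=> T1 q1; have q0 := disc_unit_neq0 q1.
have [r [qE]] := disc_unit_factor q1.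
have c0 : lead_coef q != 0 by rewrite lead_coef_eq0.
rewrite {q0}qE; elim: r => [|z r IHr] r1.
  pose G : {linear H -> H} := (lead_coef q)^-1 \*: idfun.
  rewrite big_nil alg_polyC; exists G; split=> [|x|x]; rewrite ?opolyC.
  - by exists `|(lead_coef q)^-1| => x; rewrite /= normrZ.
  - by rewrite /= scalerA divff // scale1r.
  - by rewrite /= scalerA mulVf // scale1r.
have z1 : 1 < `|z| by rewrite r1 ?mem_head.
have z0 : z != 0 by rewrite -normr_gt0 (lt_trans _ z1).
have zn0 : 0 < `|z| - 1 by rewrite subr_gt0.
have [s sr|G [Gb GK KG]] := IHr.
  by apply: r1; rewrite inE sr orbT.
have [||G1 [G1b G1K KG1]] :=
    @bounded_below_inverse _ (opoly T ('X - z%:P)) (`|z| - 1)^-1.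
- move=> y; rewrite mulrC ler_pdivlMr //= opoly_Xsub mulrBr mulr1 distrC.
  apply: le_trans (lerB_dist _ _).
  by rewrite normrZ mulrC lerD2l lerN2.
- move=> x; have [|y yx] := neumann (c := z^-1) T1 _ (- z^-1 *: x).
    by rewrite normfV invf_lt1 // (lt_trans _ z1).
  exists y; rewrite /= opoly_Xsub.
  have -> : T y - z *: y = - z *: (y - z^-1 *: T y).
    by rewrite scalerBr !scaleNr opprK scalerA divff // scale1r addrC.
  by rewrite yx scalerA mulrNN divff // scale1r.
rewrite /= in G1K KG1.
exists (G \o G1 : {linear H -> H}); split=> [|x|x] /=.
- exact: bounded_opM.
- by rewrite big_cons scalerAr opolyM GK G1K.
- by rewrite big_cons scalerAr opolyM KG1 KG.
Qed.

End inverses.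

(** * Adjoints and reversed conjugates *)

Section adjoints.
Context {R : realType} {H : hilbertType R}.
Local Notation C := R[i].
Implicit Types (X Y : H -> H) (T : {linear H -> H}) (p q : {poly C}).

Definition adjoint_op X Y : Prop := forall x y, hdot (X x) y = hdot x (Y y).

Lemma adjoint_sym X Y : adjoint_op X Y -> adjoint_op Y X.
Proof. by move=> XY x y; rewrite hdotC -XY -hdotC. Qed.

Lemma adjoint_comp X Y X' Y' : adjoint_op X X' -> adjoint_op Y Y' ->
  adjoint_op (X \o Y) (Y' \o X').
Proof. by move=> XX' YY' x y /=; rewrite XX' YY'. Qed.

Lemma adjoint_unique X Y Y' : adjoint_op X Y -> adjoint_op X Y' -> Y =1 Y'.
Proof. by move=> XY XY' y; apply: hdot_injr => z; rewrite -XY XY'. Qed.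

Lemma adjoint_comm X Y X' Y' : adjoint_op X X' -> adjoint_op Y Y' ->
  (forall x, X (Y x) = Y (X x)) -> forall x, X' (Y' x) = Y' (X' x).
Proof.
move=> XX' YY' XY; apply: (@adjoint_unique (Y \o X)); first exact: adjoint_comp.
by move=> x y /=; rewrite -XY; exact: (adjoint_comp XX' YY').
Qed.

Lemma adjoint_sum I (r : seq I) (P : pred I) (F G : I -> H -> H) :
  (forall i, adjoint_op (F i) (G i)) ->
  adjoint_op (fun x => \sum_(i <- r | P i) F i x)
             (fun x => \sum_(i <- r | P i) G i x).
Proof.
by move=> FG x y; rewrite hdot_suml hdot_sumr; apply: eq_bigr => i _; apply: FG.
Qed.

Lemma adjoint_iter X Y n : adjoint_op X Y -> adjoint_op (iter n X) (iter n Y).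
Proof. by move=> XY; elim: n => //= n IHn x y; rewrite XY IHn -iterSr. Qed.

Lemma adjoint_bound X Y (M : C) : adjoint_op X Y ->
  (forall x, `|X x| <= M * `|x|) -> forall x, `|Y x| <= M * `|x|.
Proof.
move=> XY XM x; have [->|y0] := eqVneq `|Y x| 0.
  have [->|x0] := eqVneq x 0; first by rewrite normr0 mulr0.
  by apply: le_trans (XM x).
have yp : 0 < `|Y x| by rewrite lt_def y0 normr_ge0.
rewrite -(ler_pM2l yp) -expr2 -hdot_norm -XY.
have h := cauchy_schwarz (X (Y x)) x.
have : `|hdot (X (Y x)) x| <= M * `|Y x| * `|x|.
  by apply: le_trans h _; rewrite ler_wpM2r.
by rewrite XY hdot_norm ger0_norm ?exprn_ge0 // mulrCA mulrA.
Qed.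

Lemma adjoint_contraction (T T' : {linear H -> H}) :
  contraction_op T -> adjoint_op T T' -> contraction_op T'.
Proof.
move=> T1 TT' x; rewrite -[leRHS]mul1r; apply: (adjoint_bound TT') => y.
by rewrite mul1r.
Qed.

Definition bounded_fun X : Prop := exists M : C, forall x, `|X x| <= M * `|x|.

Lemma bounded_fun_sum I (r : seq I) (P : pred I) (F : I -> H -> H) :
  (forall i, bounded_fun (F i)) ->
  bounded_fun (fun x => \sum_(i <- r | P i) F i x).
Proof.
move=> /choice[M FM]; exists (\sum_(i <- r | P i) M i) => x.
rewrite mulr_suml; apply: le_trans (ler_norm_sum _ _ _) _.
by apply: ler_sum => i _; exact: FM.
Qed.

Lemma bounded_fun_opoly T p Y : contraction_op T -> bounded_fun Y ->
  bounded_fun (fun x => opoly T p (Y x)).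
Proof.
move=> T1 [M YM]; apply: bounded_fun_sum => i.
have iterT n x : `|iter n T x| <= `|x|.
  by elim: n => //= n IHn; apply: le_trans (T1 _) IHn.
exists (`|p`_i| * M) => x; rewrite normrZ -mulrA ler_wpM2l //.
exact: le_trans (iterT _ _) (YM _).
Qed.

Lemma isometry_left_inverse T T' : isometry_op T -> adjoint_op T T' ->
  forall x, T' (T x) = x.
Proof.
move=> isoT TT' x; apply: hdot_injr => z.
by rewrite -TT' (isometry_hdot isoT).
Qed.

Lemma isometry_contraction T : isometry_op T -> contraction_op T.
Proof. by move=> isoT x; rewrite isoT. Qed.

Lemma isometry_iter T n : isometry_op T -> forall x, `|iter n T x| = `|x|.
Proof. by move=> isoT x; elim: n => //= n; rewrite isoT. Qed.

Lemma isometry_iter_hdot T n : isometry_op T -> forall x y,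
  hdot (iter n T x) (iter n T y) = hdot x y.
Proof. by move=> isoT x y; elim: n => //= n; rewrite isometry_hdot. Qed.

Definition conjpoly p : {poly C} := map_poly Num.conj p.

Lemma opoly_adjoint (T T' : {linear H -> H}) p : adjoint_op T T' ->
  adjoint_op (opoly T p) (opoly T' (conjpoly p)).
Proof.
move=> TT' x y; rewrite (@opoly_widen _ _ _ (conjpoly p) (size p)); last first.
  exact: size_poly.
rewrite /opoly hdot_suml hdot_sumr; apply: eq_bigr => i _.
by rewrite hdotZl hdotZr (adjoint_iter _ TT') coef_map conjCK.
Qed.

Lemma disc_unit_conjpoly q : disc_unit q -> disc_unit (conjpoly q).
Proof.
move=> q1 z z1; have := q1 z^*; rewrite norm_conjC => /(_ z1).
by rewrite -{2}[z]conjCK horner_map fmorph_eq0.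
Qed.

(** On the unit circle [revconj d p] is [t^d] times the complex conjugate of
    [p(t)]: for an isometry [T], it represents [p(T)^* T^d]. *)
Definition revconj d p : {poly C} := \poly_(k < d.+1) (p`_(d - k))^*.

Lemma revconjK d p : (size p <= d.+1)%N -> revconj d (revconj d p) = p.
Proof.
move=> pd; apply/polyP => k; rewrite coef_poly; case: ltnP => [kd|dk].
  by rewrite coef_poly ltnS leq_subr conjCK subKn.
by rewrite nth_default // (leq_trans pd).
Qed.

Lemma horner_revconj d p (z : C) : (size p <= d.+1)%N -> z != 0 ->
  (revconj d p).[z] = z ^+ d * (p.[(z^-1)^*])^*.
Proof.
move=> pd z0; rewrite horner_poly (horner_coef_wide _ pd) rmorph_sum mulr_sumr.
rewrite (reindex_inj rev_ord_inj) /=; apply: eq_bigr => k _.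
have kd : (k <= d)%N by rewrite -ltnS.
rewrite subSS subKn // rmorphM rmorphXn /= conjCK mulrCA exprVn.
have -> : z ^+ d = z ^+ (d - k) * z ^+ k by rewrite -exprD subnK.
by rewrite mulfK ?expf_neq0.
Qed.

(** Each term [T^k] of [p(T)] cancels [k] of the [d] factors of [T^d]. *)
Lemma hdot_opoly_revconj T d p x y : isometry_op T -> (size p <= d.+1)%N ->
  hdot (opoly T p x) (iter d T y) = hdot x (opoly T (revconj d p) y).
Proof.
move=> isoT pd; rewrite (opoly_widen _ _ pd).
rewrite (@opoly_widen _ _ _ _ d.+1) ?size_poly //.
rewrite hdot_suml hdot_sumr (reindex_inj rev_ord_inj) /=.
apply: eq_bigr => k _; have kd : (k <= d)%N by rewrite -ltnS.
rewrite subSS hdotZl hdotZr coef_poly ltn_ord conjCK; congr (_ * _).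
have -> : iter d T y = iter (d - k) T (iter k T y) by rewrite -iterD subnK.
by rewrite isometry_iter_hdot.
Qed.

End adjoints.

Section matrix_isometries.
Context {R : realType} {H : hilbertType R} {m : nat}.
Local Notation C := R[i].
Implicit Types (T : {linear H -> H}) (e : 'I_m -> 'I_m -> {linear H -> H}).

Record matrix_units e : Prop := MatrixUnits {
  mu_mul : forall i j k l x, e i j (e k l x) = e i l x *+ (j == k);
  mu_one : forall x, \sum_i e i i x = x;
  mu_adjoint : forall i j, adjoint_op (e i j) (e j i)
}.

(** The diagonal units are orthogonal projections and [|e_ij x| = |e_jj x|]. *)
Lemma matrix_units_contraction e i j : matrix_units e -> contraction_op (e i j).
Proof.
move=> [emul _ eadj].
have diag k x : `|e k k x| <= `|x|.
  have [->|k0] := eqVneq `|e k k x| 0; first by [].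
  have kp : 0 < `|e k k x| by rewrite lt_def k0 normr_ge0.
  rewrite -(ler_pM2l kp) -expr2 -hdot_norm eadj emul eqxx mulr1n mulrC.
  by rewrite -[hdot _ _]ger0_norm ?cauchy_schwarz // -(mulr1n (e k k x))
    -[1%N]/(true : nat) -(eqxx k) -emul -eadj hdot_norm exprn_ge0.
move=> x; rewrite -(@ler_pXn2r _ 2) ?nnegrE // -hdot_norm eadj emul eqxx mulr1n.
have le1 : `|hdot x (e j j x)| <= `|x| ^+ 2.
  by apply: le_trans (cauchy_schwarz _ _) _; rewrite expr2 ler_wpM2l.
apply: le_trans le1; rewrite ger0_norm // -(mulr1n (e j j x)).
by rewrite -[1%N]/(true : nat) -(eqxx i) -emul -eadj hdot_norm exprn_ge0.
Qed.

(** [T] is an isometry with adjoint [T'], such as a shift of finite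
    multiplicity, and the matrix algebra spanned by the [e_ij] commutes
    with it. *)
Record matrix_isometry (T T' : {linear H -> H}) e : Prop := MatrixIsometry {
  mi_isometry : isometry_op T;
  mi_adjoint : adjoint_op T T';
  mi_units : matrix_units e;
  mi_comm : forall i j x, e i j (T x) = T (e i j x)
}.

Lemma mi_comm_adj (T T' : {linear H -> H}) e : matrix_isometry T T' e ->
  forall i j x, e i j (T' x) = T' (e i j x).
Proof.
move=> [_ TT' [_ _ eadj] eT] i j.
exact: (adjoint_comm (eadj j i) TT' (eT j i)).
Qed.

(** The matrix [P~], equal to [t^d P(t)^*] on the unit circle. *)
Definition mxrevconj d (P : 'M[{poly C}]_m) : 'M[{poly C}]_m :=
  \matrix_(i, j) revconj d (P j i).

Definition mxconjpoly (P : 'M[{poly C}]_m) : 'M[{poly C}]_m :=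
  \matrix_(i, j) conjpoly (P j i).

Lemma mxrevconjK d (P : 'M[{poly C}]_m) : (forall i j, (size (P i j) <= d.+1)%N) ->
  mxrevconj d (mxrevconj d P) = P.
Proof. by move=> Pd; apply/matrixP => i j; rewrite !mxE revconjK. Qed.

Lemma mxop_adjoint T T' e P : matrix_isometry T T' e ->
  adjoint_op (mxop T e P) (mxop T' e (mxconjpoly P)).
Proof.
move=> MT x y; rewrite {2}/mxop exchange_big /=; move: x y.
apply: adjoint_sum => i; apply: adjoint_sum => j x y; rewrite mxE.
rewrite (opoly_adjoint _ (mi_adjoint MT)) (mu_adjoint (mi_units MT)).
by rewrite (opoly_comm (mi_comm_adj MT j i)).
Qed.

Lemma hdot_mxop_revconj T T' e (P : 'M[{poly C}]_m) d x y : matrix_isometry T T' e ->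
  (forall i j, (size (P i j) <= d.+1)%N) ->
  hdot (mxop T e P x) (iter d T y) = hdot x (mxop T e (mxrevconj d P) y).
Proof.
move=> [isoT _ [_ _ eadj] eT] Pd; rewrite hdot_suml hdot_sumr.
under eq_bigr do rewrite hdot_suml.
under [RHS]eq_bigr do rewrite hdot_sumr.
rewrite exchange_big /=; apply: eq_bigr => i _; apply: eq_bigr => j _.
rewrite hdot_opoly_revconj // eadj mxE; congr (hdot _ _).
exact: (opoly_comm (eT i j)).
Qed.

Lemma bounded_mxop T T' e P : matrix_isometry T T' e ->
  bounded_fun (mxop T e P).
Proof.
move=> MT; apply: bounded_fun_sum => i; apply: bounded_fun_sum => j.
apply: bounded_fun_opoly; first exact/isometry_contraction/(mi_isometry MT).
exists 1 => x; rewrite mul1r; exact/matrix_units_contraction/(mi_units MT).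
Qed.

End matrix_isometries.

(** * Rational symbols of operators *)

Section rational_symbols.
Context {R : realType} {H : hilbertType R} {m : nat}.
Local Notation C := R[i].
Context {T T' : {linear H -> H}} {e : 'I_m -> 'I_m -> {linear H -> H}}.
Hypothesis MT : matrix_isometry T T' e.
Implicit Types (S : {linear H -> H}) (q : {poly C}) (P : 'M[{poly C}]_m).

Let isoT := mi_isometry MT.
Let TT' := mi_adjoint MT.
Let emul := mu_mul (mi_units MT).
Let eT := mi_comm MT.

Lemma opoly_disc_unit_inj q : disc_unit q -> injective (opoly T q).
Proof.
move=> q1; have [G [_ _ KG]] := opoly_inverse (isometry_contraction isoT) q1.
exact: can_inj KG.
Qed.

(** [S] is the operator of multiplication by the rational matrix [P / q]. *)
Definition has_symbol S q P : Prop :=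
  forall x, opoly T q (S x) = mxop T e P x.

Lemma symbol_shift_comm S q P : disc_unit q -> has_symbol S q P ->
  forall x, S (T x) = T (S x).
Proof.
move=> q1 SP x; apply: (opoly_disc_unit_inj q1).
by rewrite SP mxop_shift // -SP -(opoly_comm (X := T)).
Qed.

(** The reversed conjugates clear the denominator of the adjoint on the range
    of an explicit polynomial in [T]. *)
Lemma symbol_adjoint S S' q P d : (size q <= d.+1)%N ->
  (forall i j, (size (P i j) <= d.+1)%N) ->
  has_symbol S q P -> adjoint_op S S' ->
  forall z, S' (opoly T (revconj d q) z) = mxop T e (mxrevconj d P) z.
Proof.
move=> qd Pd SP SS' z; apply: hdot_injr => y.
by rewrite -SS' -hdot_opoly_revconj // SP (hdot_mxop_revconj _ _ MT).
Qed.

(** On [w = q~(T) z] the adjoint acts by [S^* w = P~(T) z], so that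
    [q(T) S S^* w = P P~(T) z] and [q(T) S^* S w = P~ P(T) z]. *)
Lemma symbol_self_commutator S S' q P d : disc_unit q ->
  (size q <= d.+1)%N -> (forall i j, (size (P i j) <= d.+1)%N) ->
  P *m mxrevconj d P = mxrevconj d P *m P ->
  has_symbol S q P -> adjoint_op S S' ->
  forall z, let w := opoly T (revconj d q) z in S' (S w) = S (S' w).
Proof.
move=> q1 qd Pd PP SP SS' z w; apply: (opoly_disc_unit_inj q1).
have ST := symbol_shift_comm q1 SP.
rewrite SP /w (opoly_comm ST) !(symbol_adjoint qd Pd SP SS').
by rewrite -mxop_opoly // SP -!mxopM // PP.
Qed.

(** For a unitary [T], both factors of [q~(T) = T^d q(T)^*] are onto. *)
Lemma revconj_opoly_surj q d : disc_unit q -> (size q <= d.+1)%N ->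
  (forall x, T (T' x) = x) -> forall x, exists z, opoly T (revconj d q) z = x.
Proof.
move=> q1 qd TT'K x.
have T'1 := adjoint_contraction (isometry_contraction isoT) TT'.
have [G [_ GK _]] := opoly_inverse T'1 (disc_unit_conjpoly q1).
exists (iter d T' (G x)); apply: hdot_injr => y.
rewrite -hdot_opoly_revconj // (opoly_adjoint _ TT').
suff -> : iter d T (iter d T' (G x)) = G x by rewrite GK.
by elim: d {qd} (G x) => // d IHd z; rewrite iterSr iterS TT'K IHd.
Qed.

Lemma symbol_operator q P : disc_unit q ->
  exists N N' : {linear H -> H},
    [/\ bounded_op N, adjoint_op N N' & has_symbol N q P].
Proof.
move=> q1; have T1 := isometry_contraction isoT.
have T'1 := adjoint_contraction T1 TT'.
have [G [Gb GK KG]] := opoly_inverse T1 q1.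
have [G' [G'b G'K KG']] := opoly_inverse T'1 (disc_unit_conjpoly q1).
exists (G \o mxop T e P : {linear H -> H}).
exists (mxop T' e (mxconjpoly P) \o G' : {linear H -> H}); split=> [|x y|x] /=.
- have [M PM] := bounded_mxop P MT.
  by apply: bounded_opM => //; exists M.
- rewrite -(mxop_adjoint _ MT) -{1}[y]G'K -(opoly_adjoint _ TT').
  by rewrite GK.
- by rewrite GK.
Qed.

(** Dividing by [T - z] leaves a remainder in the kernel of [T'], and the
    remainders of all divisions span a finite-dimensional space. *)
Lemma range_opoly_cofinite k (u : 'I_k -> H) (r : {poly C}) :
  (forall x, T' x = 0 -> lin_span u x) ->
  r != 0 -> (forall z, root r z -> `|z| < 1) ->
  exists n (f : 'I_n -> H), forall x, exists z, lin_span f (x - opoly T r z).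
Proof.
move=> kerT' r0 r1; have [s rE] := closed_field_poly_normal r.
have {r1} : forall z, z \in s -> `|z| < 1.
  by move=> z zs; apply: r1; rewrite rE rootZ ?lead_coef_eq0 // root_prod_XsubC.
have c0 : lead_coef r != 0 by rewrite lead_coef_eq0.
rewrite {r0}rE; elim: s => [|z s IHs] s1.
  exists 0%N, (fun=> 0) => x; exists ((lead_coef r)^-1 *: x), (fun=> 0).
  by rewrite big_ord0 big_nil alg_polyC opolyC scalerA divff // scale1r subrr.
have [w ws|n [f fP]] := IHs; first by apply: s1; rewrite inE ws orbT.
have z1 : `|z| < 1 by rewrite s1 ?mem_head.
have T'1 := adjoint_contraction (isometry_contraction isoT) TT'.
have spl (i : 'I_n) : fintype.split (lshift k i) = inl i.
  exact: (unsplitK (inl i)).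
have spr (i : 'I_k) : fintype.split (rshift n i) = inr i.
  exact: (unsplitK (inr i)).
exists (n + k)%N, (fun i : 'I_(n + k) => match fintype.split i with
  | inl j => opoly T ('X - z%:P) (f j) | inr j => u j end) => x.
have [y yx] := neumann T'1 z1 (T' x).
have [w [c wc]] := fP y; exists w.
have [|c' c'E] := kerT' (x - opoly T ('X - z%:P) y).
  rewrite opoly_Xsub opprB linearD linearB linearZ /= -{1}yx.
  by rewrite (isometry_left_inverse isoT TT') addrA subrK subrr.
exists (fun i : 'I_(n + k) =>
  match fintype.split i with inl j => c j | inr j => c' j end).
rewrite big_split_ord /=.
under [X in _ = X + _]eq_bigr => i _ do rewrite !spl.
under [X in _ = _ + X]eq_bigr => i _ do rewrite !spr.
rewrite -c'E big_cons scalerAr opolyM -{1}(subrK (opoly T ('X - z%:P) y) x).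
rewrite -addrA addrC; congr (_ + _).
rewrite -linearB /= wc linear_sum; apply: eq_bigr => i _.
by rewrite linearZ.
Qed.

(** The nonzero zeros of [q~] are those of [q], reflected in the unit circle. *)
Lemma revconj_roots q d : disc_unit q -> (size q <= d.+1)%N ->
  revconj d q != 0 /\ forall z, root (revconj d q) z -> `|z| < 1.
Proof.
move=> q1 qd; split=> [|z].
  have := disc_unit_neq0 q1; apply: contraNneq => q0.
  apply/eqP/polyP => k; rewrite coef0; case: (ltnP k d.+1) => kd.
    have := congr1 (fun p : {poly C} => p`_(d - k)) q0.
    rewrite coef0 coef_poly ltnS leq_subr subKn // => /eqP.
    by rewrite conjC_eq0 => /eqP.
  by rewrite nth_default // (leq_trans qd).
have [->|z0] := eqVneq z 0; first by rewrite normr0 ltr01.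
rewrite real_ltNge ?normr_real // rootE horner_revconj // mulf_eq0.
rewrite expf_eq0 (negbTE z0) andbF conjC_eq0 => /= qz; apply/negP => z1.
have := q1 (z^-1)^*; rewrite qz => /(_ _)/negP; apply=> //.
by rewrite norm_conjC normfV invf_le1 // normr_gt0.
Qed.

(** The self-commutator vanishes on the range of [q~(T)], which has finite
    codimension since the zeros of [q~] lie in the disc. *)
Lemma symbol_finite_rank k (u : 'I_k -> H) S S' q P d :
  (forall x, T' x = 0 -> lin_span u x) -> disc_unit q ->
  (size q <= d.+1)%N -> (forall i j, (size (P i j) <= d.+1)%N) ->
  P *m mxrevconj d P = mxrevconj d P *m P ->
  has_symbol S q P -> adjoint_op S S' ->
  finite_rank (fun x => S' (S x) - S (S' x)).
Proof.
move=> kerT' q1 qd Pd PP SP SS'.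
have [r0 r1] := revconj_roots q1 qd.
have [n [f fP]] := range_opoly_cofinite kerT' r0 r1.
exists n, (fun i => S' (S (f i)) - S (S' (f i))) => _ [x _ <-].
have [z [c cE]] := fP x; exists c.
have /= w0 := symbol_self_commutator q1 qd Pd PP SP SS' z.
set w := opoly T _ z in cE w0.
have -> : S' (S x) - S (S' x) = S' (S (x - w)) - S (S' (x - w)).
  by rewrite !(linearB S) !(linearB S') !(linearB S) w0 opprB addrA subrK.
rewrite cE (linear_sum S) (linear_sum S') /= (linear_sum S') (linear_sum S) /=.
rewrite -sumrB; apply: eq_bigr => i _.
rewrite scalerBr; congr (_ - _).
  by rewrite linearZ /= linearZ.
by rewrite linearZ /= linearZ.
Qed.

End rational_symbols.

(** * Purity of operators with a rational symbol *)

Section eigenvectors.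
Context {R : realType} {H : hilbertType R}.
Local Notation C := R[i].

(** A vector annihilated by a nonzero polynomial in an operator is carried to
    an eigenvector by some product of linear factors of the polynomial. *)
Lemma opoly_eigenvector (T : {linear H -> H}) (p : {poly C}) (x : H) :
  p != 0 -> x != 0 -> opoly T p x = 0 -> exists c y, y != 0 /\ T y = c *: y.
Proof.
move=> p0 x0; have [s ->] := closed_field_poly_normal p.
rewrite opolyZ => /eqP; rewrite scaler_eq0 lead_coef_eq0 (negbTE p0) /= {p0}.
elim: s x x0 => [|z s IHs] x x0; first by rewrite big_nil opolyC scale1r (negbTE x0).
rewrite big_cons mulrC opolyM opoly_Xsub.
have [/subr0_eq Tx _|] := eqVneq (T x - z *: x) 0; first by exists z, x.
exact: IHs.
Qed.

End eigenvectors.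

(** The preimages of a convergent sequence in the range form a Cauchy
    sequence. *)
Lemma isometry_range_closed {R : realType} {H K : hilbertType R}
    (J : {linear H -> K}) (u : nat -> K) (l : K) : isometry_op J ->
  (forall n, exists y, u n = J y) ->
  (forall eps : R[i], 0 < eps -> exists n, `|u n - l| <= eps) ->
  exists y, l = J y.
Proof.
move=> isoJ uJ ul.
have half : (0 : R[i]) <= (2^-1 : R[i]) < 1.
  by apply/andP; split; [rewrite invr_ge0|rewrite invf_lt1 ?ltr1n].
have small (eps : R[i]) : 0 < eps -> exists n, (2^-1) ^+ n <= eps.
  by move=> /(expr_lt1_small half)[n ne]; exists n; rewrite ltW.
have /choice[y yP] k : exists y, `|J y - l| <= (2^-1) ^+ k.
  have [|n un] := ul ((2^-1) ^+ k); first by rewrite exprn_gt0 // invr_gt0.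
  by have [y uy] := uJ n; exists y; rewrite -uy.
have ydist n k : (n <= k)%N -> `|y n - y k| <= 2 * (2^-1 : R[i]) ^+ n.
  move=> nk; rewrite -isoJ linearB.
  apply: le_trans (ler_distD l _ _) _; rewrite mulr_natl mulr2n; apply: lerD=> //.
  rewrite distrC; apply: le_trans (yP k) _.
  by apply: ler_wiXn2l; rewrite ?invr_ge0 ?invf_le1 ?ler1n.
have [eps e0|z zP] := complete_limit ydist.
  have [n ne] := small _ (divr_gt0 e0 (ltr0n _ 2)).
  by exists n; rewrite mulrC -ler_pdivlMr.
exists z; apply/subr0_eq/(@norm_small_eq0 _ _ _ 3) => // eps e0.
have [n ne] := small _ e0.
apply: le_trans (ler_distD (J (y n)) _ _) _.
rewrite distrC (_ : 3 = 1 + 2); last by rewrite -natr1 addrC.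
rewrite mulrDl mul1r; apply: lerD; first exact: le_trans (yP n) ne.
rewrite -linearB isoJ; apply: le_trans (zP n) _.
by rewrite ler_wpM2l.
Qed.

Section purity.
Context {R : realType} {H K : hilbertType R} {m : nat}.
Local Notation C := R[i].
Context {V B : {linear H -> H}} {e : 'I_m.+1 -> 'I_m.+1 -> {linear H -> H}}.
Hypothesis MV : matrix_isometry V B e.
Hypothesis decay : forall x (eps : C), 0 < eps -> exists n, `|iter n B x| <= eps.
Context {S : {linear H -> H}} {q : {poly C}} {P : 'M[{poly C}]_m.+1}.
Hypothesis q1 : disc_unit q.
Hypothesis SP : has_symbol (T := V) (e := e) S q P.

Let isoV := mi_isometry MV.
Let VB := mi_adjoint MV.

(** Cayley-Hamilton for the matrix [P / q]. *)
Lemma symbol_cayley_hamilton x :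
  \sum_(i < m.+2) opoly V ((char_poly P)`_i * q ^+ i) (iter i S x) = 0.
Proof.
have [emul eone _] := mi_units MV; have eV := mi_comm MV.
have SV := symbol_shift_comm MV q1 SP.
have qS z : opoly V q (S z) = S (opoly V q z) by rewrite (opoly_comm SV).
have powP i y : mxop V e (P ^+ i) y = opoly V (q ^+ i) (iter i S y).
  elim: i y => [|i IHi] y.
    by rewrite !expr0 opolyC scale1r mxop_scalar // opolyC scale1r.
  rewrite exprSr mxopM // IHi -SP -(iter_comm (X := opoly V q) qS).
  by rewrite /= -opolyM -exprSr -iterSr.
have sz : size (char_poly P) = m.+2 by rewrite size_char_poly.
transitivity (mxop V e (horner_mx P (char_poly P)) x); last first.
  by rewrite Cayley_Hamilton mxop0.
rewrite -[in RHS](coefK (char_poly P)) poly_def sz rmorph_sum /=.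
have mxop_sum (F : 'I_m.+2 -> 'M[{poly C}]_m.+1) :
    mxop V e (\sum_i F i) x = \sum_i mxop V e (F i) x.
  by elim/big_rec2: _ => [|i y A _ <-]; rewrite ?mxop0 ?mxopD.
rewrite mxop_sum; apply: eq_bigr => i _.
rewrite horner_mxZ rmorphXn /= horner_mx_X -mul_scalar_mx mxopM // mxop_scalar //.
by rewrite powP opolyM.
Qed.

Context {J : {linear H -> K}} {N N' W : {linear K -> K}}.
Hypothesis isoJ : isometry_op J.
Hypothesis NJ : forall x, N (J x) = J (S x).
Hypothesis NN' : adjoint_op N N'.
Hypothesis normalN : forall x, N (N' x) = N' (N x).
Hypothesis N'b : bounded_op N'.
Hypothesis WJ : forall x, W (J x) = J (V x).
Hypothesis N'W : forall x, N' (W x) = W (N' x).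

(** The vectors of [H] that no power of [N^*] moves out of [H]. Every invariant
    subspace on which [S] is normal lies in it, and it is moreover invariant
    under [V]. *)
Definition normal_part : set H :=
  [set x | forall k, exists y, iter k N' (J x) = J y].

Lemma normal_part_lin (c : C) x y :
  normal_part x -> normal_part y -> normal_part (c *: x + y).
Proof.
move=> Ax Ay k; have [x' xx'] := Ax k; have [y' yy'] := Ay k.
by exists (c *: x' + y'); rewrite linearP iter_linear xx' yy' linearP.
Qed.

Lemma normal_part0 : normal_part 0.
Proof. by move=> k; exists 0; rewrite linear0 iter0. Qed.

Lemma normal_part_V x : normal_part x -> normal_part (V x).
Proof.
move=> Ax k; have [y xy] := Ax k; exists (V y).
by rewrite -!WJ -xy (iter_comm (X := W)).
Qed.

Lemma normal_part_S x : normal_part x -> normal_part (S x).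
Proof.
move=> Ax k; have [y xy] := Ax k; exists (S y).
by rewrite -!NJ -xy (iter_comm (X := N)).
Qed.

Lemma normal_part_adj x : normal_part x ->
  exists2 y, normal_part y & N' (J x) = J y.
Proof.
move=> Ax; have [y xy] := Ax 1%N; exists y => // k.
by have [z xz] := Ax k.+1; exists z; rewrite -xz iterSr -xy.
Qed.

Lemma normal_part_closed (u : nat -> H) l : (forall n, normal_part (u n)) ->
  (forall eps : C, 0 < eps -> exists n, `|u n - l| <= eps) -> normal_part l.
Proof.
move=> Au ul k.
have [M M0 N'M] := bounded_op_nonneg N'b.
apply: (@isometry_range_closed _ _ _ _ (fun n => iter k N' (J (u n)))) => //.
  by move=> n; exact: Au.
move=> eps e0.
have kM z : `|iter k N' z| <= M ^+ k * `|z|.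
  elim: k => [|k IHk]; first by rewrite expr0 mul1r.
  by apply: le_trans (N'M _) _; rewrite exprS -mulrA ler_wpM2l.
have Mk : 0 < 1 + M ^+ k by rewrite ltr_pwDl // exprn_ge0.
have [n un] := ul _ (divr_gt0 e0 Mk); exists n.
have -> : iter k N' (J (u n)) - iter k N' (J l) = iter k N' (J (u n - l)).
  by rewrite linearB iterB.
apply: le_trans (kM _) _; rewrite isoJ.
move: un; rewrite ler_pdivlMr // => /(le_trans _); apply.
by rewrite mulrC ler_wpM2l // lerDr.
Qed.

(** If [S1] is the adjoint of [S] on [A], then [S1 x] is the compression of
    [N^* x] to [A]; they coincide since [|N^* x| = |S x| = |S1 x|]. *)
Lemma normal_subset (A : set H) : invariant_subspace S A -> normal_on A S ->
  A `<=` normal_part.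
Proof.
move=> [_ SA] [S1 [S1A SS1] comm].
have A1 x : A x -> A (S1 x) by move=> Ax; apply: S1A; exists x.
have AS x : A x -> A (S x) by move=> Ax; apply: SA; exists x.
have N'J x : A x -> N' (J x) = J (S1 x).
  move=> Ax; apply/subr0_eq/hdotxx_eq0.
  have e1 : hdot (N' (J x)) (N' (J x)) = hdot (S1 x) (S1 x).
    rewrite -NN' normalN (adjoint_sym NN') NJ (isometry_hdot isoJ).
    rewrite (SS1 _ _ Ax (AS _ Ax)) -comm // [LHS]hdotC.
    by rewrite (SS1 _ _ (A1 _ Ax) Ax) -hdotC.
  have e2 : hdot (J (S1 x)) (N' (J x)) = hdot (S1 x) (S1 x).
    by rewrite -NN' NJ (isometry_hdot isoJ) (SS1 _ _ (A1 _ Ax) Ax).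
  rewrite hdotBl !hdotBr e1 e2 (hdotC (N' (J x))) e2 (isometry_hdot isoJ).
  by rewrite -hdotC subrr.
move=> x Ax k; elim: k x Ax => [|k IHk] x Ax; first by exists x.
by rewrite iterSr N'J //; apply: IHk; exact: A1.
Qed.

Hypothesis no_eigenvector : forall (c : C) x, N x = c *: x -> x = 0.

(** The wandering subspace [A - V A] of the normal part [A] is invariant under
    [S], and the constant term of the Cayley-Hamilton identity, which maps
    [A] into [V A], kills it. *)
Lemma wandering_eq0 x : normal_part x ->
  (forall y, normal_part y -> hdot x (V y) = 0) -> x = 0.
Proof.
move=> Ax xV; have [//|x0] := eqVneq x 0.
pose E := [set z | normal_part z /\ forall y, normal_part y -> hdot z (V y) = 0].
have ES z : E z -> E (S z).
  move=> [Az zV]; split=> [|y Ay]; first exact: normal_part_S.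
  have [y' Ay' yy'] := normal_part_adj Ay.
  rewrite -(isometry_hdot isoJ) -NJ NN' -WJ N'W yy' WJ (isometry_hdot isoJ).
  exact: zV.
have Eiter k : E (iter k S x) by elim: k => //= k; exact: ES.
pose b i := (char_poly P)`_i * q ^+ i.
have split0 (p : {poly C}) : exists p', p = p' * 'X + (p`_0)%:P.
  elim/poly_ind: p => [|p c _]; first by exists 0; rewrite mul0r coef0 addr0.
  by exists p; rewrite coefD coefMX coefC add0r.
have /choice[b' bE] i : exists p', b i = p' * 'X + ((b i)`_0)%:P by exact: split0.
have Eop0 : opoly S (\poly_(i < m.+2) (b i)`_0) x = 0.
  apply: hdotxx_eq0; set z := opoly _ _ _.
  have Ez : E z.
    rewrite /z (@opoly_widen _ _ _ _ m.+2) ?size_poly //.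
    elim/big_rec: _ => [|i y _ [Ay yV]].
      by split=> [|y _]; [exact: normal_part0|rewrite hdot0l].
    have [Ai iV] := Eiter i; split=> [|w Aw]; first exact: normal_part_lin.
    by rewrite hdotDl hdotZl iV // yV // mulr0 addr0.
  have zE : z = V (- \sum_(i < m.+2) opoly V (b' i) (iter i S x)).
    apply/eqP; rewrite linearN -addr_eq0; apply/eqP.
    rewrite -[RHS](symbol_cayley_hamilton x) /z.
    rewrite (@opoly_widen _ _ _ _ m.+2) ?size_poly // linear_sum -big_split /=.
    apply: eq_bigr => i _; rewrite coef_poly ltn_ord -/(b i) [in RHS]bE.
    by rewrite opolyD opolyMX opolyC addrC.
  rewrite [X in hdot _ X]zE; apply: Ez.2.
  rewrite -sumrN; elim/big_rec: _ => [|i y _ Ay]; first exact: normal_part0.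
  rewrite -scaleN1r; apply: normal_part_lin => //.
  rewrite /opoly; elim/big_rec: _ => [|j w _ Aw]; first exact: normal_part0.
  apply: normal_part_lin => //; have := (Eiter i).1.
  by elim: (nat_of_ord j) => //= k IHk Ai; apply/normal_part_V/IHk.
(* The leading coefficient is that of the characteristic polynomial times
   [q(0) ^+ m.+1]. *)
have p0 : \poly_(i < m.+2) (b i)`_0 != 0.
  apply/eqP => /(congr1 (fun p : {poly C} => p`_m.+1)).
  rewrite coef0 coef_poly ltnSn /b.
  have -> : (char_poly P)`_m.+1 = 1.
    have := char_poly_monic P; rewrite monicE lead_coefE size_char_poly.
    by move/eqP.
  rewrite mul1r -horner_coef0 horner_exp => /eqP; apply/negP.
  by rewrite expf_neq0 // q1 // normr0.
have [c [y [y0 Sy]]] := opoly_eigenvector p0 x0 Eop0.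
case/negP: y0; apply/eqP/(isometry_inj isoJ); rewrite linear0.
by apply: (no_eigenvector (c := c)); rewrite NJ Sy linearZ.
Qed.

(** By the orthogonal decomposition of the normal part [A] along [V A], which
    has no wandering vectors, [A = V A]: every vector of [A] is divisible by all
    powers of [V], and [B^n] tends to zero. *)
Lemma normal_part_eq0 x : normal_part x -> x = 0.
Proof.
have VBK := isometry_left_inverse isoV VB.
have divV y : normal_part y -> exists2 z, normal_part z & y = V z.
  move=> Ay; pose M := [set V z | z in normal_part].
  have [||u l Mu ul|p [z Az <-] yz] := @orthogonal_projection _ _ M y.
  - by exists 0; [exact: normal_part0|rewrite linear0].
  - move=> c _ _ [z1 A1 <-] [z2 A2 <-]; exists (c *: z1 + z2).
      exact: normal_part_lin.
    by rewrite linearP.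
  - have Bl eps : 0 < eps -> exists2 n, `|B (u n) - B l| <= eps & `|u n - l| <= eps.
      move=> /ul[n un]; exists n => //; rewrite -linearB.
      exact: le_trans (adjoint_contraction (isometry_contraction isoV) VB _) un.
    exists (B l).
      apply: (@normal_part_closed (B \o u)) => [n|eps /Bl[n Bn _]]; last by exists n.
      by rewrite /=; have [z Az <-] := Mu n; rewrite VBK.
    apply/subr0_eq/(@norm_small_eq0 _ _ _ 2) => // eps /Bl[n Bn un].
    apply: le_trans (ler_distD (u n) _ _) _; rewrite mulr_natl mulr2n.
    apply: lerD => //; rewrite distrC; have [z _ uz] := Mu n.
    by rewrite -[u n]uz -[in V z](VBK z) uz -linearB isoV.
  exists z => //; apply/subr0_eq/wandering_eq0 => [|w Aw].
    by rewrite addrC -scaleN1r; apply: normal_part_lin => //; exact: normal_part_V.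
  by apply: yz; exists w.
move=> Ax; apply: (@norm_small_eq0 _ _ _ 1) => // eps /(decay x)[n Bn].
rewrite mul1r; apply: le_trans Bn.
have [y [_ ->]] : exists y, normal_part y /\ x = iter n V y.
  elim: n => [|n [y [Ay ->]]]; first by exists x.
  have [z Az ->] := divV _ Ay; exists z; split=> //.
  by rewrite iterSr.
rewrite (_ : iter n B (iter n V y) = y) ?isometry_iter //.
by elim: n => // n IHn; rewrite iterSr iterS VBK.
Qed.

Theorem symbol_pure : pure_op S.
Proof.
by move=> A invA normA x /(normal_subset invA normA)/normal_part_eq0.
Qed.

End purity.

(** * Shifts of finite multiplicity *)

Section vector_shifts.
Context {R : realType} {H : hilbertType R} {m : nat}.
Local Notation C := R[i].

(** A shift of multiplicity [m], as an abstract operator: [B] is the backward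
    shift and [u_i] the [i]-th constant function. *)
Record vector_shift (V B : {linear H -> H})
    (e : 'I_m -> 'I_m -> {linear H -> H}) (u : 'I_m -> H) : Prop := VectorShift {
  vs_isometry : matrix_isometry V B e;
  vs_decay : forall x (eps : C), 0 < eps -> exists n, `|iter n B x| <= eps;
  vs_ker : forall x, B x = 0 -> lin_span u x;
  vs_Bu : forall i, B (u i) = 0;
  vs_eu : forall i j k, e i j (u k) = u i *+ (j == k);
  vs_u0 : forall i, u i != 0
}.

Context {V B : {linear H -> H}} {e : 'I_m -> 'I_m -> {linear H -> H}}.
Context {u : 'I_m -> H}.
Hypothesis VS : vector_shift V B e u.
Implicit Types (S : {linear H -> H}) (p q : {poly C}) (P : 'M[{poly C}]_m).

Let MV := vs_isometry VS.
Let isoV := mi_isometry MV.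
Let VB := mi_adjoint MV.
Let VBK : forall x, B (V x) = x := isometry_left_inverse isoV VB.
Let eV := mi_comm MV.
Let emul := mu_mul (mi_units MV).
Let eone := mu_one (mi_units MV).

Lemma backward_shift_fixed (c : C) x : `|c| <= 1 -> x = c *: B x -> x = 0.
Proof.
move=> c1 xB; apply: (@norm_small_eq0 _ _ _ 1) => // eps.
move=> /(vs_decay VS x)[n xn]; rewrite mul1r; apply: le_trans xn.
elim: n => //= n IHn; apply: le_trans IHn _.
rewrite {1}xB -[_ *: B x]addr0 iter_linear iter0 addr0 -iterSr normrZ.
by rewrite ler_piMl.
Qed.

Lemma shift_no_eigenvector (c : C) x : V x = c *: x -> x = 0.
Proof.
move=> Vx; have [//|x0] := eqVneq x 0.
apply: (@backward_shift_fixed c); last by rewrite -linearZ -Vx VBK.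
have := isoV x; rewrite Vx normrZ -{2}[`|x|]mul1r => /mulIf ->//.
by rewrite normr_eq0.
Qed.

Lemma opoly_shift_eq0 p x : p != 0 -> opoly V p x = 0 -> x = 0.
Proof.
move=> p0 px; have [//|x0] := eqVneq x 0.
have [c [y [/negP y0 Vy]]] := opoly_eigenvector p0 x0 px.
by case: y0; apply/eqP/(shift_no_eigenvector Vy).
Qed.

Definition polyvec (a : 'I_m -> {poly C}) : H := \sum_i opoly V (a i) (u i).

Lemma polyvec_eq0 a : polyvec a = 0 -> forall i, a i = 0.
Proof.
move=> a0 i; apply/eqP; apply: contraT => ai0.
have /negP := vs_u0 VS i; case; apply/eqP/(opoly_shift_eq0 ai0).
have := congr1 (e i i) a0; rewrite linear0 linear_sum /= (bigD1 i) //=.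
rewrite (opoly_comm (eV i i)) (vs_eu VS) eqxx mulr1n big1 ?addr0 // => j ji.
by rewrite (opoly_comm (eV i i)) (vs_eu VS) eq_sym (negbTE ji) mulr0n linear0.
Qed.

Lemma mxop_u P j : mxop V e P (u j) = polyvec (fun i => P i j).
Proof.
rewrite /mxop; apply: eq_bigr => i _; rewrite (bigD1 j) //= (vs_eu VS) eqxx.
rewrite mulr1n big1 ?addr0 // => k kj.
by rewrite (vs_eu VS) (negbTE kj) mulr0n linear0.
Qed.

Lemma mxop_eq0 P : (forall j, mxop V e P (u j) = 0) -> P = 0.
Proof.
move=> P0; apply/matrixP => i j; rewrite mxE.
by have := P0 j; rewrite mxop_u => /polyvec_eq0/(_ i).
Qed.

Lemma opoly_polyvec p a : opoly V p (polyvec a) = polyvec (fun i => p * a i).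
Proof. by rewrite linear_sum; apply: eq_bigr => i _; rewrite opolyM. Qed.

(** This is the Taylor expansion, with zero remainder. *)
Lemma backward_nilpotent_polyvec n z : iter n B z = 0 -> exists a, z = polyvec a.
Proof.
elim: n z => [|n IHn] z /=.
  by move=> ->; exists (fun=> 0); rewrite /polyvec big1 // => i _; rewrite opoly0.
rewrite -iterS iterSr => /IHn[a Bz].
have [|c cE] := vs_ker VS (x := z - V (B z)).
  by rewrite linearB VBK subrr.
exists (fun i => a i * 'X + (c i)%:P).
rewrite -[LHS](subrK (V (B z))) cE addrC {1}Bz linear_sum -big_split /=.
by apply: eq_bigr => i _; rewrite opolyD opolyMX opolyC.
Qed.

(** Modulo constants, which [S] kills, [x] equals [V B x]; so
    [S x = V^n S B^n x] for every [n]. *)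
Lemma shift_commutant_eq0 S : bounded_op S -> (forall x, S (V x) = V (S x)) ->
  (forall j, S (u j) = 0) -> forall x, S x = 0.
Proof.
move=> /bounded_op_nonneg[M M0 SM] SV Su x.
have Sn n : S x = iter n V (S (iter n B x)).
  elim: n => //= n ->; rewrite -iterS iterSr; congr (iter n V _).
  have [|c cE] := vs_ker VS (x := iter n B x - V (B (iter n B x))).
    by rewrite linearB VBK subrr.
  rewrite -[in LHS](subrK (V (B (iter n B x))) (iter n B x)) linearD cE.
  rewrite linear_sum big1 ?add0r ?SV // => i _.
  by rewrite linearZ /= Su scaler0.
apply: (@norm_small_eq0 _ _ _ M) => // eps /(vs_decay VS x)[n xn].
rewrite (Sn n) isometry_iter //; apply: le_trans (SM _) _.
by rewrite ler_wpM2l.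
Qed.

Lemma has_symbol_u S q P : bounded_op S -> (forall x, S (V x) = V (S x)) ->
  (forall j, opoly V q (S (u j)) = mxop V e P (u j)) ->
  has_symbol (T := V) (e := e) S q P.
Proof.
move=> Sb SV Su x; apply: subr0_eq.
pose X : {linear H -> H} := (opoly V q \o S) \- mxop V e P.
rewrite -[LHS]/(X x); apply: shift_commutant_eq0 x.
- have [M XM] : bounded_fun (fun x => opoly V q (S x)).
    by apply: bounded_fun_opoly Sb; exact: isometry_contraction.
  have [M' PM] := bounded_mxop P MV.
  exists (M + M') => x; rewrite mulrDl; apply: le_trans (ler_normB _ _) _.
  apply: lerD; [exact: XM|exact: PM].
- move=> x; rewrite /= SV (mxop_shift eV) linearB /=.
  by rewrite (opoly_comm (X := V)).
- by move=> j; rewrite /= Su subrr.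
Qed.

(** A zero [z] of the denominator in the closed disc cancels: if [(V - z) y] is
    a constant function, then [y = z B y], hence [y = 0]. *)
Lemma symbol_reduce S q P : q != 0 -> has_symbol (T := V) (e := e) S q P ->
  exists q1 P1, disc_unit q1 /\ has_symbol (T := V) (e := e) S q1 P1.
Proof.
have [n] := ubnP (size q); elim: n => // n IHn in q P *.
rewrite ltnS => qn q0 SP; have [q1|] := pselect (disc_unit q).
  by exists q, P.
move=> /existsNP[z] /not_implyP[z1] /negP; rewrite negbK => qz.
have /factor_theorem[q1 qE] : root q z by [].
have q10 : q1 != 0 by apply: contraNneq q0 => q10; rewrite qE q10 mul0r.
pose P1 : 'M[{poly C}]_m := \matrix_(i, j) (P i j %/ ('X - z%:P)).
have PE i j : P i j = P1 i j * ('X - z%:P) + (P i j).[z]%:P.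
  by rewrite mxE {1}(divp_eq (P i j) ('X - z%:P)) modp_XsubC.
have Pz j : polyvec (fun i => (P i j).[z]%:P) = 0.
  pose y := opoly V q1 (S (u j)) - mxop V e P1 (u j).
  have yz : opoly V ('X - z%:P) y = polyvec (fun i => (P i j).[z]%:P).
    rewrite linearB /= -opolyM mulrC -qE SP !mxop_u opoly_polyvec -sumrB.
    apply: eq_bigr => i _; rewrite -opolyB; congr (opoly V _ _).
    by rewrite {1}PE mulrC addrAC subrr add0r.
  rewrite -yz; suff -> : y = 0 by rewrite linear0.
  apply: (backward_shift_fixed z1); apply/subr0_eq.
  have := congr1 B yz; rewrite opoly_Xsub linearB linearZ /= VBK => ->.
  rewrite linear_sum big1 // => i _.
  by rewrite opolyC linearZ /= (vs_Bu VS) scaler0.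
have {}PE : P = ('X - z%:P)%:M *m P1.
  apply/matrixP => i j; rewrite mul_scalar_mx mxE [LHS]PE.
  by have := polyvec_eq0 (Pz j) i => /= ->; rewrite addr0 mulrC.
apply: (IHn q1 P1) => // [|x].
  by move: qn; rewrite qE size_Mmonic ?monicXsubC // size_XsubC addn2.
apply: subr0_eq; apply: (@opoly_shift_eq0 ('X - z%:P)).
  by rewrite polyXsubC_eq0.
by rewrite linearB /= -opolyM mulrC -qE SP PE mxopM // mxop_scalar // subrr.
Qed.

End vector_shifts.

(** * The symbol of a subnormal operator *)

Section finite_rank_lemma.
Context {R : realType} {H : hilbertType R}.
Local Notation C := R[i].

Lemma adjoint_linear (S : {linear H -> H}) (S' : H -> H) :
  adjoint_op S S' -> exists S1 : {linear H -> H}, S1 =1 S'.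
Proof.
move=> SS'; have lin : linear S'.
  move=> c x y; apply: hdot_injr => z.
  by rewrite hdotDr hdotZr -!SS' hdotDr hdotZr.
pose S1 : {linear H -> H} :=
  HB.pack S' (GRing.isLinear.Build C H H *:%R S' lin).
by exists S1.
Qed.

(** The combination is encoded as a polynomial, which becomes a denominator. *)
Lemma finite_rank_dependence (D : {linear H -> H}) n (f : 'I_n -> H)
    (w : nat -> H) : (forall x, lin_span f (D x)) ->
  exists2 p : {poly C}, p != 0 & (size p <= n.+1)%N /\
    D (\sum_(k < n.+1) p`_k *: w k) = 0.
Proof.
move=> Df; have /choice[c cE] k : exists c, D (w k) = \sum_i c i *: f i by exact: Df.
pose M : 'M[C]_(n.+1, n) := \matrix_(k, i) c k i.
have : kermx M != 0.
  rewrite kermx_eq0 /row_free eqn_leq negb_and -!ltnNge.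
  by rewrite (leq_ltn_trans (rank_leq_col M)) ?orbT.
move/rowV0Pn => [v /sub_kermxP vM v0].
exists (\poly_(k < n.+1) v 0 (inord k)).
  apply: contra_neq v0 => p0; apply/rowP => k; rewrite mxE.
  have := congr1 (fun p : {poly C} => p`_k) p0.
  by rewrite coef0 coef_poly ltn_ord inord_val.
split; first exact: size_poly.
rewrite linear_sum /=; under eq_bigr => k _.
  rewrite linearZ /= coef_poly ltn_ord inord_val cE scaler_sumr.
  under eq_bigr do rewrite scalerA.
  over.
rewrite exchange_big /= big1 // => i _; rewrite -scaler_suml.
have := congr1 (fun r : 'rV_n => r 0 i) vM; rewrite !mxE => vMi.
rewrite (_ : \sum_(k < n.+1) _ = 0) ?scale0r // -[RHS]vMi.
by apply: eq_bigr => k _; rewrite mxE.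
Qed.

End finite_rank_lemma.

Section self_commutator.
Context {R : realType} {H K : hilbertType R} {m : nat}.
Local Notation C := R[i].
Context {V B : {linear H -> H}} {e : 'I_m -> 'I_m -> {linear H -> H}}.
Context {u : 'I_m -> H}.
Hypothesis VS : vector_shift V B e u.
Context {S S' : {linear H -> H}}.
Hypothesis Sb : bounded_op S.
Hypothesis SS' : adjoint_op S S'.
Hypothesis SV : forall x, S (V x) = V (S x).
Context {J : {linear H -> K}} {N : {linear K -> K}} {N' : K -> K}.
Hypothesis isoJ : isometry_op J.
Hypothesis NJ : forall x, N (J x) = J (S x).
Hypothesis NN' : adjoint_op N N'.
Hypothesis normalN : forall x, N (N' x) = N' (N x).

Let MV := vs_isometry VS.
Let isoV := mi_isometry MV.
Let VB := mi_adjoint MV.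
Let VBK : forall x, B (V x) = x := isometry_left_inverse isoV VB.
Let eV := mi_comm MV.
Let emul := mu_mul (mi_units MV).
Let eone := mu_one (mi_units MV).

Definition self_commuting : set H := [set x | S' (S x) = S (S' x)].

Lemma self_commuting_lin (c : C) x y :
  self_commuting x -> self_commuting y -> self_commuting (c *: x + y).
Proof.
rewrite /self_commuting /= => Ex Ey; rewrite (linearP S) (linearP S') Ex Ey.
by rewrite (linearP S') (linearP S).
Qed.

Let normN' x : `|N' (J x)| ^+ 2 = `|S x| ^+ 2.
Proof.
by rewrite -hdot_norm -NN' normalN (adjoint_sym NN') NJ (isometry_hdot isoJ) hdot_norm.
Qed.

Let cross x : hdot (J (S' x)) (N' (J x)) = `|S' x| ^+ 2.
Proof. by rewrite -NN' NJ (isometry_hdot isoJ) SS' hdot_norm. Qed.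

(** [S^* x] is the projection of [N^* x] to [H], and [|N^* x| = |S x|]. *)
Lemma hyponormal x : `|S' x| <= `|S x|.
Proof.
have [->//|s0] := eqVneq `|S' x| 0.
have sp : 0 < `|S' x| by rewrite lt_def s0 normr_ge0.
rewrite -(ler_pM2l sp) -expr2 -cross.
have : `|N' (J x)| = `|S x|.
  by apply: (@pexpIrn _ 2) => //; rewrite ?nnegrE // normN'.
move=> <-; rewrite -[`|S' x|](isoJ (S' x)).
by rewrite -[leLHS]ger0_norm ?cauchy_schwarz // cross exprn_ge0.
Qed.

(** Equality of the norms forces the projection [S^* x] of [N^* x] to be [N^* x]
    itself. *)
Lemma self_commutingP x : self_commuting x <-> `|S' x| = `|S x|.
Proof.
split=> [Ex|nx].
  apply: (@pexpIrn _ 2) => //; rewrite ?nnegrE //.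
  by rewrite -!hdot_norm -SS' -Ex (adjoint_sym SS').
have N'J : N' (J x) = J (S' x).
  apply/subr0_eq/hdotxx_eq0; rewrite hdot_norm hnormB_sqr normN' isoJ.
  rewrite (hdotC (N' (J x))) cross nx conj_Creal ?rpredX ?normr_real //.
  by rewrite subrr.
apply: hdot_injr => z.
rewrite -[RHS](isometry_hdot isoJ) -NJ -N'J normalN.
by rewrite -NN' !NJ (isometry_hdot isoJ) SS'.
Qed.

(** [S' V x = V (S' x) + (a constant)], where the constant has to vanish since
    [S'] does not increase the norm beyond that of [S]. *)
Lemma self_commuting_shift x : self_commuting x ->
  S' (V x) = V (S' x) /\ self_commuting (V x).
Proof.
move=> /self_commutingP nx.
have BS' : B (S' (V x)) = S' x.
  by apply: hdot_injr => z; rewrite -VB -!SS' SV (isometry_hdot isoV).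
have eqS : S' (V x) = V (S' x).
  apply/subr0_eq/normr0_eq0/eqP; rewrite -sqrf_eq0 eq_le exprn_ge0 // andbT.
  have orth : hdot (V (S' x)) (S' (V x) - V (S' x)) = 0.
    by rewrite VB linearB VBK BS' subrr hdot0r.
  have := hnormD_orth orth; rewrite addrC subrK isoV => nE.
  have le : `|S' (V x)| ^+ 2 <= `|S' x| ^+ 2.
    rewrite ler_pXn2r ?nnegrE // nx -(isoV (S x)) -SV; exact: hyponormal.
  by move: le; rewrite nE gerDl.
by split=> //; apply/self_commutingP; rewrite eqS SV !isoV.
Qed.

Lemma self_commuting_iter n x : self_commuting x ->
  S' (iter n V x) = iter n V (S' x) /\ self_commuting (iter n V x).
Proof.
move=> Ex; elim: n => //= n [IHn En].
by have [-> En1] := self_commuting_shift En; rewrite IHn.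
Qed.

Lemma self_commuting_opoly p x : self_commuting x -> self_commuting (opoly V p x).
Proof.
move=> Ex; rewrite /opoly; elim/big_rec: _ => [|k y _ Ey].
  by rewrite /self_commuting /= !linear0.
by apply: self_commuting_lin => //; have [] := self_commuting_iter k Ex.
Qed.

(** The vector [S^* V^(n+1) x = V^(n+1) S^* x] is orthogonal to the constants. *)
Lemma self_commuting_orth x n j : self_commuting x ->
  hdot x (iter n.+1 B (S (u j))) = 0.
Proof.
move=> Ex; rewrite -(adjoint_iter _ VB) -(adjoint_sym SS').
by have [-> _] := self_commuting_iter n.+1 Ex; rewrite /= VB (vs_Bu VS) hdot0r.
Qed.

Context {n : nat} {f : 'I_n -> H}.
Hypothesis rankD : forall x, lin_span f (S' (S x) - S (S' x)).

Let D : {linear H -> H} := (S' \o S) \- (S \o S').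

Lemma self_commuting_dependence (w : nat -> H) :
  exists2 p : {poly C}, p != 0 & (size p <= n.+1)%N /\
    self_commuting (\sum_(k < n.+1) p`_k *: w k).
Proof.
have [p p0 [pn pE]] := @finite_rank_dependence _ _ D n f w rankD.
by exists p => //; split=> //; exact: subr0_eq.
Qed.

(** Kronecker's criterion: the vectors [B^(k+1) S u_j] are orthogonal to the
    kernel of the self-commutator, so that a relation modulo this kernel is a
    genuine relation, that is a linear recurrence for the Taylor coefficients
    of [S u_j]. *)
Lemma column_rational j : exists2 q : {poly C}, q != 0 &
  exists a, opoly V q (S (u j)) = polyvec (V := V) (u := u) a.
Proof.
have [p p0 [pn Ep]] := self_commuting_dependence (fun k => iter k.+1 B (S (u j))).
have {Ep} rel : \sum_(k < n.+1) p`_k *: iter k.+1 B (S (u j)) = 0.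
  set x := \sum_(k < _) _ in Ep *; apply: hdotxx_eq0.
  rewrite {2}/x hdot_sumr big1 // => k _.
  by rewrite hdotZr self_commuting_orth // mulr0.
(* A recurrence for the Taylor coefficients is a denominator read backwards. *)
exists (\poly_(k < n.+1) p`_(n - k)).
  apply: contra_neq p0 => q0; apply/polyP => k; rewrite coef0.
  have [kn|nk] := ltnP k n.+1; last by rewrite nth_default // (leq_trans pn).
  have := congr1 (fun q : {poly C} => q`_(n - k)) q0.
  by rewrite coef0 coef_poly ltnS leq_subr subKn.
apply: (backward_nilpotent_polyvec VS (n := n.+1)).
rewrite -[RHS]rel (@opoly_widen _ _ _ _ n.+1) ?size_poly //.
rewrite iter_sum (reindex_inj rev_ord_inj); apply: eq_bigr => k _.
have kn : (k <= n)%N by rewrite -ltnS.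
rewrite iterZ [nat_of_ord (rev_ord k)]/= subSS coef_poly ltnS leq_subr subKn //.
congr (_ *: _).
have -> : iter n.+1 B =1 iter k.+1 B \o iter (n - k) B.
  by move=> y; rewrite /= -iterD subnKC.
rewrite [LHS]/= /comp; congr (iter k.+1 B _).
by elim: (n - k)%N => // l IHl; rewrite iterSr iterS VBK.
Qed.

Lemma operator_rational : exists q P, q != 0 /\ has_symbol (T := V) (e := e) S q P.
Proof.
have /choice[q qP] j : exists q : {poly C}, q != 0 /\
    exists a, opoly V q (S (u j)) = polyvec (V := V) (u := u) a.
  by have [q q0 [a aE]] := column_rational j; exists q; split=> //; exists a.
have /choice[a aE] j : exists a,
    opoly V (q j) (S (u j)) = polyvec (V := V) (u := u) a by exact: (qP j).2.
exists (\prod_j q j), (\matrix_(i, j) ((\prod_(k | k != j) q k) * a j i)); split.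
  by apply/prodf_neq0 => j _; exact: (qP j).1.
apply: (has_symbol_u VS) => // j; rewrite (mxop_u VS) (bigD1 j) //= mulrC opolyM.
rewrite aE opoly_polyvec; apply: eq_bigr => i _; by rewrite mxE.
Qed.

(** On the vectors that [q~(V)] maps into the kernel of the self-commutator,
    [P(V)] and [P~(V)] have the same norm; these vectors contain a multiple
    [r(V) u_j] of each [u_j]. *)
Lemma symbol_normal q (P : 'M[{poly C}]_m) d : disc_unit q -> (size q <= d.+1)%N ->
  (forall i j, (size (P i j) <= d.+1)%N) ->
  has_symbol (T := V) (e := e) S q P ->
  P *m mxrevconj d P = mxrevconj d P *m P.
Proof.
move=> q1 qd Pd SP; set Pr := mxrevconj d P; set qr := revconj d q.
have Prd i j : (size (Pr i j) <= d.+1)%N by rewrite mxE size_poly.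
have Sop p x : S (opoly V p x) = opoly V p (S x) by rewrite (opoly_comm SV).
have /choice[r0 r0P] j :
    exists r : {poly C}, r != 0 /\ self_commuting (opoly V r (u j)).
  have [r r0 [rn Er]] := self_commuting_dependence (fun k => iter k V (u j)).
  by exists r; split=> //; rewrite (opoly_widen _ _ rn).
pose r := \prod_j r0 j.
have rn0 : r != 0 by apply/prodf_neq0 => j _; exact: (r0P j).1.
pose X := [set x | self_commuting (opoly V qr x)].
have linX (c : C) x y : X x -> X y -> X (c *: x + y).
  by rewrite /X /= linearP; exact: self_commuting_lin.
have X_opoly p x : X x -> X (opoly V p x).
  by rewrite /X /= -opolyM mulrC opolyM; exact: self_commuting_opoly.
have Xr j : X (opoly V r (u j)).
  rewrite /X /= /r (bigD1 j) //= mulrC -opolyM mulrA opolyM.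
  exact: self_commuting_opoly (r0P j).2.
have norm_qr z : `|opoly V qr z| = `|opoly V q z|.
  apply: (@pexpIrn _ 2) => //; rewrite ?nnegrE // -!hdot_norm.
  rewrite -(hdot_opoly_revconj _ _ isoV qd) -opolyM mulrC opolyM.
  by rewrite hdot_opoly_revconj ?size_poly // revconjK.
have normX x : X x -> `|mxop V e Pr x| = `|mxop V e P x|.
  move=> /self_commutingP; rewrite (symbol_adjoint MV qd Pd SP SS') => ->.
  by rewrite Sop norm_qr SP.
have gram x y : X x -> X y -> hdot (mxop V e (P *m Pr - Pr *m P) x) (iter d V y) = 0.
  move=> Xx Xy; rewrite mxopB !mxopM // hdotBl.
  rewrite (hdot_mxop_revconj _ _ MV Pd) (hdot_mxop_revconj _ _ MV Prd) mxrevconjK //.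
  by rewrite (eq_norm_hdot linX normX) // subrr.
set Q := P *m Pr - Pr *m P in gram.
apply: subr0_eq; apply: (mxop_eq0 VS) => j.
apply: (opoly_shift_eq0 VS rn0); rewrite -(mxop_opoly eV).
set x := opoly V r (u j); apply: hdotxx_eq0.
have XV : X (iter d V x) by rewrite -opolyXn; apply: X_opoly; exact: Xr.
have XQ : X (mxop V e Q x).
  rewrite /x (mxop_opoly eV) (mxop_u VS) opoly_polyvec /polyvec.
  elim/big_rec: _ => [|i y _ Xy].
    by rewrite /X /= linear0 /self_commuting /= !linear0.
  rewrite -[opoly _ _ _]scale1r; apply: (linX) => //.
  by rewrite mulrC opolyM; exact: X_opoly.
rewrite -[RHS](gram _ _ XV XQ) -(isometry_iter_hdot d isoV); congr (hdot _ _).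
by rewrite -!opolyXn (mxop_opoly eV).
Qed.

End self_commutator.

Section nondegeneracy.
Context {R : realType} {H : hilbertType R} {m : nat}.
Local Notation C := R[i].
Context {V B : {linear H -> H}} {e : 'I_m -> 'I_m -> {linear H -> H}}.
Context {u : 'I_m -> H}.
Hypothesis VS : vector_shift V B e u.

(** A polynomial vector in the kernel of [P - c q] is an eigenvector. *)
Lemma symbol_eigenvector (S : {linear H -> H}) q (P : 'M[{poly C}]_m) (c : C) :
  disc_unit q -> has_symbol (T := V) (e := e) S q P ->
  \det (P - (c *: q)%:M) = 0 -> exists2 x, x != 0 & S x = c *: x.
Proof.
move=> q1 SP det0; have MV := vs_isometry VS.
have [emul eone _] := mi_units MV; have eV := mi_comm MV.
set A := P - _ in det0.
have /eqP/det0P[v v0 vA] : \det A^T = 0 by rewrite det_tr.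
have /rV0Pn[j vj] := v0.
pose M : 'M[{poly C}]_m := \matrix_(i, k) v 0 i.
have AM : A *m M = 0.
  apply/matrixP => i k; have := congr1 (fun r : 'rV_m => r 0 i) vA.
  rewrite !mxE => h; rewrite -[RHS]h; apply: eq_bigr => l _.
  by rewrite !mxE mulrC.
exists (mxop V e M (u j)).
  rewrite (mxop_u VS); apply: contra_neq vj => /(polyvec_eq0 VS)/(_ j).
  by rewrite mxE.
apply: (opoly_disc_unit_inj MV q1); apply: subr0_eq.
rewrite SP linearZ /= -opolyZ -(mxop_scalar _ eone) -mxopB -mxopM // AM.
exact: mxop0.
Qed.

End nondegeneracy.

(** * Taylor series and square-summable sequences *)

Lemma norm_real_complex {R : realType} (x : R) : `|x%:C%C| = (`|x|)%:C%C :> R[i].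
Proof.
have [x0|x0] := ger0P x; first by rewrite ger0_norm // lecR.
by rewrite ltr0_norm ?ltcR // rmorphN.
Qed.

Section taylor_series.
Context {R : realType} {m : nat}.
Local Notation C := R[i].

(** At [t > 0] the first nonzero coefficient is bounded by the tail of a
    geometric series with factor [t]. *)
Lemma power_series_eq0 (c : nat -> C) (M : C) : (forall n, `|c n| <= M) ->
  (forall t : C, `|t| < 1 ->
    series (fun n => c n * t ^+ n : C^o) @ \oo --> (0 : C^o)) ->
  forall n, c n = 0.
Proof.
move=> cM c0; have M0 : 0 <= M by exact: le_trans (cM 0%N).
elim/ltn_ind => n IHn.
apply: (@norm_small_eq0 _ C^o _ (2 * M + 1)).
  by rewrite addr_ge0 // mulr_ge0.
move=> eps e0; pose t := eps / (2 * (1 + eps)).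
have e1 : 0 < 1 + eps by rewrite addr_gt0.
have t0 : 0 < t by rewrite divr_gt0 // mulr_gt0.
have tn0 k : 0 < t ^+ k by rewrite exprn_gt0.
have te : t <= eps.
  rewrite ler_pdivrMr ?mulr_gt0 // ler_peMr ?ltW //.
  by rewrite mulr_natl mulr2n -addrA ltrDl addr_gt0.
have t2 : t <= 2^-1.
  by rewrite /t invfM mulrCA ger_pMr ?invr_gt0 // ler_pdivrMr // mul1r lerDr.
have t1 : t < 1 by apply: le_lt_trans t2 _; rewrite invf_lt1 // ltr1n.
have tN : `|t| = t by rewrite ger0_norm // ltW.
have tN1 : `|t| < 1 by rewrite tN.
have /cvgrPdist_lt/(_ _ (tn0 n.+1))[N _ cN] := c0 t tN1.
have := cN (maxn N n.+1) (leq_maxl _ _); rewrite sub0r normrN /series /=.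
set L := maxn _ _; have nL : (n < L)%N by exact: leq_maxr.
rewrite (big_cat_nat _ (ltnW nL)) //= [X in X + _]big_nat big1 ?add0r; last first.
  by move=> k /andP[_ kn]; rewrite IHn // mul0r.
rewrite big_ltn // => small.
have tail : `|\sum_(n.+1 <= k < L) c k * t ^+ k| <= 2 * M * t ^+ n.+1.
  have geo l : \sum_(n.+1 <= k < n.+1 + l) t ^+ k <=
      2 * t ^+ n.+1 - 2 * t ^+ (n.+1 + l).
    elim: l => [|l IHl]; first by rewrite addn0 big_geq // subrr.
    rewrite addnS big_nat_recr ?leq_addr //=.
    apply: le_trans (lerD IHl (lexx _)) _; rewrite -addrA lerD2l.
    have tt : 2 * t <= 1 by rewrite mulrC -ler_pdivlMr // div1r.
    rewrite {1}(mulr_natl _ 2) mulr2n opprD subrK lerN2 exprS mulrA.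
    by rewrite ler_piMl // ltW.
  apply: le_trans (ler_norm_sum _ _ _) _.
  apply: le_trans (ler_sum _ (fun k _ => _ : _ <= M * t ^+ k)) _.
    move=> k _; rewrite normrM (ger0_norm (ltW (tn0 k))).
    exact: ler_wpM2r (ltW (tn0 k)) _ _ (cM k).
  rewrite -mulr_sumr (mulrC 2 M) -mulrA ler_wpM2l //.
  rewrite -(subnKC nL); apply: le_trans (geo _) _.
  by rewrite lerBlDr lerDl mulr_ge0 // ltW.
rewrite -(@ler_pM2r _ (t ^+ n)) //.
have : `|c n * t ^+ n| <= t ^+ n.+1 + 2 * M * t ^+ n.+1.
  rewrite -[c n * _](addrK (\sum_(n.+1 <= k < L) c k * t ^+ k)).
  apply: le_trans (ler_normB _ _) _; apply: lerD tail; exact: ltW.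
rewrite normrM (ger0_norm (ltW (tn0 n))) => /le_trans; apply.
rewrite addrC -[X in _ + X]mul1r -mulrDl exprS mulrA.
apply: ler_wpM2r (ltW (tn0 n)) _ _ _; by rewrite ler_wpM2l ?addr_ge0 ?mulr_ge0.
Qed.

Definition taylor (f : disc R -> 'cV[C]_m) (a : nat -> 'cV[C]_m) : Prop :=
  forall (t : disc R) j,
    series (fun n => a n j 0 * val t ^+ n : C^o) @ \oo --> (f t j 0 : C^o).

Lemma taylor_comb (c : C) f a g b : taylor f a -> taylor g b ->
  taylor (c *: f + g) (fun n => c *: a n + b n).
Proof.
move=> fa gb t j; rewrite [X in _ --> X](_ : _ = c * f t j 0 + g t j 0); last first.
  by rewrite !mxE.
rewrite (_ : series _ = fun n =>
    c * series (fun n => a n j 0 * val t ^+ n : C^o) n +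
    series (fun n => b n j 0 * val t ^+ n : C^o) n).
  have h := @cvgD C _ _ _ _ _ _ _ _
    (@cvgM C _ _ _ _ _ _ _ (cvg_cst (c : C^o)) (fa t j)) (gb t j).
  exact: h.
apply/funext => n; rewrite /series /= mulr_sumr -big_split /=.
by apply: eq_bigr => k _; rewrite !mxE mulrDl mulrA.
Qed.

Lemma taylor_unique f a b (M M' : C) : taylor f a -> taylor f b ->
  (forall n j, `|a n j 0| <= M) -> (forall n j, `|b n j 0| <= M') ->
  forall n, a n = b n.
Proof.
move=> fa fb aM bM n; apply/colP => j; apply/eqP; rewrite -subr_eq0; apply/eqP.
apply: (@power_series_eq0 (fun n => a n j 0 - b n j 0) (M + M')) n => [n|t t1].
  by apply: le_trans (ler_normB _ _) _; exact: lerD.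
pose t' : disc R := exist _ t t1.
have := @taylor_comb (-1) _ _ _ _ fb fa t' j.
rewrite (_ : (- 1 *: f + f) t' j 0 = 0); last by rewrite !mxE mulN1r addNr.
suff -> : (fun n => (a n j 0 - b n j 0) * t ^+ n : C^o) =
  (fun n => (-1 *: b n + a n) j 0 * val t' ^+ n) by [].
by apply/funext => k; rewrite !mxE mulN1r addrC.
Qed.

Lemma taylor_shift f a : taylor f a -> taylor (fun t => val t *: f t)
  (fun n => if n is k.+1 then a k else 0).
Proof.
move=> fa t j; rewrite mxE.
rewrite -(cvg_shiftn 1).
rewrite (_ : (fun n => _) = fun n =>
    val t * series (fun n => a n j 0 * val t ^+ n : C^o) n).
  exact: cvgM (cvg_cst _) (fa t j).
apply/funext => n; rewrite /series /= addn1 big_nat_recl //= mxE mul0r add0r mulr_sumr.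
by apply: eq_bigr => k _; rewrite exprS mulrCA.
Qed.

Lemma taylor_cst (v : 'cV[C]_m) :
  taylor (fun=> v) (fun n => if n is _.+1 then 0 else v).
Proof.
move=> t j; rewrite -(cvg_shiftn 1) (_ : (fun n => _) = fun=> v j 0).
  exact: cvg_cst.
apply/funext => n; rewrite /series /= addn1 big_nat_recl //= mulr1 big1 ?addr0 //.
by move=> k _; rewrite mxE mul0r.
Qed.

(** The squared norm is real-valued, for use in extended real sums. *)
Definition nsq (v : 'cV[C]_m) : R :=
  \sum_j (complex.Re (v j 0) ^+ 2 + complex.Im (v j 0) ^+ 2).

Lemma nsqE v : (nsq v)%:C%C = \sum_j `|v j 0| ^+ 2.
Proof. by rewrite rmorph_sum; apply: eq_bigr => j _; rewrite /= add_Re2_Im2. Qed.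

Lemma nsq_ge0 v : 0 <= nsq v.
Proof. by apply: sumr_ge0 => j _; rewrite addr_ge0 ?sqr_ge0. Qed.

Lemma nsq_coord (v : 'cV[C]_m) j : `|v j 0| ^+ 2 <= (nsq v)%:C%C.
Proof. by rewrite nsqE (bigD1 j) //= lerDl sumr_ge0 // => k _; rewrite exprn_ge0. Qed.

Lemma nsq0 : nsq 0 = 0.
Proof. by apply: big1 => j _; rewrite mxE /= expr0n addr0. Qed.

Lemma nsqN v : nsq (- v) = nsq v.
Proof. by apply: eq_bigr => j _; rewrite mxE !raddfN /= !sqrrN. Qed.

Lemma nsqZ c v : (nsq (c *: v))%:C%C = `|c| ^+ 2 * (nsq v)%:C%C.
Proof.
by rewrite !nsqE mulr_sumr; apply: eq_bigr => j _; rewrite mxE normrM exprMn.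
Qed.

Lemma nsq_eq0 v : nsq v = 0 -> v = 0.
Proof.
move=> v0; apply/colP => j; rewrite mxE; apply/eqP.
rewrite -normr_eq0 -sqrf_eq0 eq_le exprn_ge0 // andbT.
by rewrite -[leRHS]/(0%:C%C) -v0 nsq_coord.
Qed.

(** As an unordered sum, this is invariant under reindexing. *)
Definition sqsum (a : nat -> 'cV[C]_m) : \bar R := \esum_(n in setT) (nsq (a n))%:E.

Lemma series_sqsum (a : nat -> 'cV[C]_m) (r : R) :
  series (fun n => \sum_(j < m) `|a n j 0| ^+ 2 : C^o) @ \oo --> (r%:C%C : C^o) ->
  sqsum a = r%:E.
Proof.
move=> ar; have cvR : series (fun n => nsq (a n)) @ \oo --> r.
  apply/cvgrPdist_lt => eps e0; have e0' : 0 < eps%:C%C :> C by rewrite ltcR.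
  move/cvgrPdist_lt/(_ _ e0') : ar => [N _ aN]; exists N => // n /aN /=.
  rewrite /series /= (_ : \sum_(0 <= k < n) \sum_(j < m) _ =
    (\sum_(0 <= k < n) nsq (a k))%:C%C); last first.
    by rewrite rmorph_sum; apply: eq_bigr => k _; rewrite /= nsqE.
  by rewrite -rmorphB norm_real_complex ltcR.
rewrite /sqsum -nneseries_esumT => [|n]; last by rewrite lee_fin nsq_ge0.
apply/cvg_lim => //; rewrite (_ : (fun n => _) = EFin \o series (fun n => nsq (a n))).
  by apply: cvg_EFin => //; exact: nearW.
by apply/funext => n; rewrite /= -sumEFin.
Qed.

Lemma sqsum_partial (a : nat -> 'cV[C]_m) (r : R) : sqsum a = r%:E ->
  (forall n, \sum_(0 <= k < n) nsq (a k) <= r) /\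
  (forall eps, 0 < eps -> exists n, r - \sum_(0 <= k < n) nsq (a k) < eps).
Proof.
rewrite /sqsum -nneseries_esumT => [ar|n]; last by rewrite lee_fin nsq_ge0.
have a0 k : (0 <= k)%N -> xpredT k -> (0 <= (nsq (a k))%:E)%E.
  by move=> _ _; rewrite lee_fin nsq_ge0.
split=> [n|eps e0].
  by rewrite -lee_fin -ar -sumEFin; apply: nneseries_lim_ge.
have cv : (fun n => \sum_(0 <= k < n) (nsq (a k))%:E) @ \oo --> r%:E.
  rewrite -ar; apply: ereal_nondecreasing_is_cvgn.
  exact: ereal_nondecreasing_series.
have [_] := (fine_cvgP _ _).1 cv.
move/cvgrPdist_lt/(_ _ e0) => [N _ /(_ N (leqnn N)) /=].
rewrite sumEFin /= => h; exists N; apply: le_lt_trans h; exact: ler_norm.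
Qed.

End taylor_series.

(** * Operators given by Taylor coefficients *)

Section coefficients.
Context {R : realType} {H : hilbertType R} {m : nat}.
Local Notation C := R[i].

Definition nsqr (x : H) : R := complex.Re (`|x| ^+ 2).

Lemma nsqrE x : (nsqr x)%:C%C = `|x| ^+ 2.
Proof. by rewrite RRe_real // rpredX // normr_real. Qed.

(** [coef] identifies [H] with the square-summable sequences of vectors of
    [C^m], and [V] with the shift. *)
Record coefficients (V : {linear H -> H}) (coef : H -> nat -> 'cV[C]_m) : Prop :=
Coefficients {
  co_lin : forall (c : C) x y n,
    coef (c *: x + y) n = c *: coef x n + coef y n;
  co_norm : forall x, sqsum (coef x) = (nsqr x)%:E;
  co_V : forall x n, coef (V x) n = if n is k.+1 then coef x k else 0;
  co_cst : forall v, exists x, forall n, coef x n = if n is _.+1 then 0 else v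
}.

Lemma kolmogorov_wold_coefficients (V : {linear H -> H})
    (U : {linear H -> (disc R -> 'cV[C]_m)}) : kolmogorov_wold V U ->
  exists coef, coefficients V coef /\ forall x, taylor (U x) (coef x).
Proof.
move=> [[_ Uinj Usurj] Uiso Ushift].
have /choice[coef coefP] x : exists a, taylor (U x) a /\ sqsum a = (nsqr x)%:E.
  have [a ta sa] := Uiso x; exists a; split=> //.
  by apply: series_sqsum; rewrite nsqrE.
have bnd x : exists M : C, forall n j, `|coef x n j 0| <= M.
  exists `|x| => n j; have [_ sx] := coefP x; have [sn _] := sqsum_partial sx.
  rewrite -(@ler_pXn2r _ 2) ?nnegrE // -nsqrE.
  apply: le_trans (nsq_coord _ _) _; rewrite lecR; apply: le_trans (sn n.+1).
  by rewrite big_nat_recr //= lerDr sumr_ge0 // => k _; exact: nsq_ge0.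
have uniq x b : taylor (U x) b ->
    (exists M : C, forall n j, `|b n j 0| <= M) -> forall n, coef x n = b n.
  move=> tb [M bM]; have [M' xM'] := bnd x.
  exact: taylor_unique (coefP x).1 tb xM' bM.
exists coef; split=> [|x]; last exact: (coefP x).1.
split=> [c x y n|x|x n|v].
- apply: (uniq _ (fun n => c *: coef x n + coef y n)).
    by rewrite linearP; apply: taylor_comb; exact: (coefP _).1.
  have [M xM] := bnd x; have [M' yM] := bnd y.
  exists (`|c| * M + M') => k j; rewrite !mxE; apply: le_trans (ler_normD _ _) _.
  by rewrite normrM lerD // ler_wpM2l.
- exact: (coefP x).2.
- apply: (uniq _ (fun n => if n is k.+1 then coef x k else 0)).
    have UVx : conj_op U V (U x) = U (V x).
      by rewrite /conj_op /= pinvKV ?inE.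
    rewrite -UVx Ushift; first exact: taylor_shift (coefP x).1.
    by exists (`|x| ^+ 2); exact: Uiso.
  have [M xM] := bnd x; exists M => -[|k] j; last exact: xM.
  by rewrite mxE normr0 (le_trans _ (xM 0%N j)).
- have [x _ Ux] : exists2 x, setT x & U x = (fun=> v).
    apply: Usurj; exists (\sum_j `|v j 0| ^+ 2).
    pose a0 (n : nat) : 'cV[C]_m := if n is _.+1 then 0 else v.
    exists a0; first exact: taylor_cst.
    rewrite -(cvg_shiftn 1) (_ : (fun n => _) = fun=> \sum_j `|v j 0| ^+ 2).
      exact: cvg_cst.
    apply/funext => n; rewrite /series /= addn1 big_nat_recl //=.
    rewrite [X in _ + X]big1 ?addr0 //.
    by move=> k _; rewrite big1 // => j _; rewrite mxE normr0 expr0n.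
  exists x; apply: (uniq _ (fun n => if n is _.+1 then 0 else v)).
    by rewrite Ux; exact: taylor_cst.
  exists (Num.sqrt (nsq v))%:C%C => -[|n] j; last first.
    by rewrite mxE normr0 lecR sqrtr_ge0.
  have s0 : 0 <= (Num.sqrt (nsq v))%:C%C by rewrite lecR sqrtr_ge0.
  rewrite -(@ler_pXn2r _ 2) ?nnegrE //.
  by rewrite -[leRHS]rmorphXn sqr_sqrtr ?nsq_ge0 ?nsq_coord.
Qed.

Context {V : {linear H -> H}} {coef : H -> nat -> 'cV[C]_m}.
Hypothesis CO : coefficients V coef.

Lemma coefD x y n : coef (x + y) n = coef x n + coef y n.
Proof. by rewrite -[x]scale1r (co_lin CO) !scale1r. Qed.

Lemma coefB x y n : coef (x - y) n = coef x n - coef y n.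
Proof. by rewrite addrC -scaleN1r (co_lin CO) scaleN1r addrC. Qed.

Lemma coef0 n : coef 0 n = 0.
Proof. by rewrite -(subrr 0) coefB subrr. Qed.

Lemma nsqr_eq0 x : nsqr x = 0 -> x = 0.
Proof.
move=> x0; apply/normr0_eq0/eqP; rewrite -sqrf_eq0 -nsqrE x0.
by rewrite eqxx.
Qed.

Lemma coef_partial x : (forall n, \sum_(0 <= k < n) nsq (coef x k) <= nsqr x) /\
  (forall eps, 0 < eps -> exists n, nsqr x - \sum_(0 <= k < n) nsq (coef x k) < eps).
Proof. exact: sqsum_partial (co_norm CO x). Qed.

Lemma coef_inj x y : (forall n, coef x n = coef y n) -> x = y.
Proof.
move=> xy; apply/subr0_eq/nsqr_eq0/EFin_inj; rewrite -(co_norm CO) /sqsum.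
by apply: esum1 => n _; rewrite coefB xy subrr nsq0.
Qed.

Lemma nsq_coef x n : nsq (coef x n) <= nsqr x.
Proof.
apply: le_trans ((coef_partial x).1 n.+1).
by rewrite big_nat_recr //= lerDr sumr_ge0 // => k _; exact: nsq_ge0.
Qed.

Lemma sqsum_le (a : nat -> 'cV[C]_m) (r : R) :
  (forall n, \sum_(0 <= k < n) nsq (a k) <= r) -> (sqsum a <= r%:E)%E.
Proof.
move=> ar; rewrite /sqsum -nneseries_esumT => [|n]; last by rewrite lee_fin nsq_ge0.
apply: lime_le; first by apply: is_cvg_nneseries => n _ _; rewrite lee_fin nsq_ge0.
by apply: nearW => n; rewrite sumEFin lee_fin.
Qed.

(** The truncations of the sequence form a Cauchy sequence of polynomials. *)
Lemma coef_surj (a : nat -> 'cV[C]_m) (r : R) : (sqsum a <= r%:E)%E ->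
  exists x, forall n, coef x n = a n.
Proof.
move=> ar.
have a_fin : sqsum a = (fine (sqsum a))%:E.
  rewrite fineK // fin_real // (lt_le_trans (ltNyr 0)) ?esum_ge0 //=.
    by rewrite (le_lt_trans ar) ?ltry.
  by move=> n _; rewrite lee_fin nsq_ge0.
have [Sle Ssup] := sqsum_partial a_fin; set s := fine _ in Sle Ssup.
have /choice[c cP] := co_cst CO.
pose t N := \sum_(0 <= k < N) iter k V (c (a k)).
have coef_sum n (F : nat -> H) N :
    coef (\sum_(0 <= k < N) F k) n = \sum_(0 <= k < N) coef (F k) n.
  elim: N => [|N IHN]; first by rewrite !big_geq // coef0.
  by rewrite !big_nat_recr //= coefD IHN.
have coef_iter k v n : coef (iter k V (c v)) n = if n == k then v else 0.
  elim: k n => [|k IHk] [|n] /=; rewrite ?cP // (co_V CO) //.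
have coef_t N n : coef (t N) n = if (n < N)%N then a n else 0.
  rewrite coef_sum; under eq_bigr do rewrite coef_iter.
  case: ltnP => nN; last first.
    rewrite big_nat big1 // => k /andP[_ kN].
    by case: eqP => // nk; move: kN; rewrite -nk ltnNge nN.
  rewrite (bigD1_seq n) ?mem_index_iota ?iota_uniq //= eqxx big1 ?addr0 // => k kn.
  by rewrite eq_sym (negbTE kn).
have tdist N k : (N <= k)%N ->
    `|t N - t k| <= (Num.sqrt (s - \sum_(0 <= k < N) nsq (a k)))%:C%C.
  move=> Nk; have sN : 0 <= s - \sum_(0 <= k < N) nsq (a k) by rewrite subr_ge0.
  rewrite -(@ler_pXn2r _ 2) ?nnegrE ?lecR ?sqrtr_ge0 // -rmorphXn sqr_sqrtr //.
  rewrite -nsqrE lecR -lee_fin -(co_norm CO); apply: sqsum_le => n.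
  have ge0 i : true -> 0 <= nsq (coef (t N - t k) i) by move=> _; exact: nsq_ge0.
  apply: (@le_trans _ _ (\sum_(0 <= i < N + n) nsq (coef (t N - t k) i))).
    by rewrite [leRHS](big_cat_nat (n := n)) ?leq_addl //= lerDl sumr_ge0.
  rewrite [leLHS](big_cat_nat (n := N)) ?leq_addr //= [X in X + _]big_nat big1.
    rewrite add0r; apply: (@le_trans _ _ (\sum_(N <= i < N + n) nsq (a i))).
      rewrite big_nat [leRHS]big_nat; apply: ler_sum => i /andP[Ni _].
      rewrite coefB !coef_t ltnNge Ni /= sub0r nsqN.
      by case: ifP => // _; rewrite nsq0 nsq_ge0.
    rewrite lerBrDr addrC; have := Sle (N + n)%N.
    by rewrite (big_cat_nat (n := N)) ?leq_addr.
  move=> i /andP[_ iN]; rewrite coefB !coef_t iN (leq_trans iN Nk) subrr.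
  exact: nsq0.
have small (eps : C) : 0 < eps ->
    exists N, (Num.sqrt (s - \sum_(0 <= k < N) nsq (a k)))%:C%C <= eps.
  move=> /complex_gt0P[d d0 ->]; have [N sN] := Ssup _ (exprn_gt0 2 d0).
  exists N; rewrite lecR -[leRHS](ger0_norm (ltW d0)) -sqrtr_sqr.
  by rewrite ler_wsqrtr // ltW.
have [x tx] := complete_limit tdist small.
exists x => n; apply/colP => j; apply/subr0_eq/(@norm_small_eq0 _ C^o _ 1) => // eps.
move=> /small[N sN]; rewrite mul1r; pose L := maxn N n.+1.
have -> : coef x n j 0 - a n j 0 = coef (x - t L) n j 0.
  by rewrite coefB coef_t leq_maxr !mxE.
apply: (@le_trans _ _ `|x - t L|).
  rewrite -(@ler_pXn2r _ 2) ?nnegrE // -nsqrE.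
  by apply: le_trans (nsq_coord _ _) _; rewrite lecR nsq_coef.
rewrite distrC; apply: le_trans (tx L) (le_trans _ sN).
rewrite lecR ler_wsqrtr // lerD2l lerN2 [leRHS](big_cat_nat (n := N)) ?leq_maxl //=.
by rewrite lerDl sumr_ge0 // => k _; exact: nsq_ge0.
Qed.

(** The shifts, the matrix units and the embedding of the unilateral shift in
    the bilateral one are all obtained in this way. *)
Lemma coef_operator (L : (nat -> 'cV[C]_m) -> nat -> 'cV[C]_m) :
  (forall (c : C) a b n, L (fun k => c *: a k + b k) n = c *: L a n + L b n) ->
  (forall a, (sqsum (L a) <= sqsum a)%E) ->
  exists F : {linear H -> H}, forall x n, coef (F x) n = L (coef x) n.
Proof.
move=> linL Lle.
have /choice[f fL] x : exists y, forall n, coef y n = L (coef x) n.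
  by apply: (@coef_surj _ (nsqr x)); rewrite -(co_norm CO).
have lin_f : linear f.
  move=> c x y; apply: coef_inj => n; rewrite fL (co_lin CO) !fL -linL.
  by congr (L _ n); apply/funext => k; rewrite (co_lin CO).
pose F : {linear H -> H} := HB.pack f (GRing.isLinear.Build C H H *:%R f lin_f).
by exists F.
Qed.

Lemma sqsum_pullback (s : nat -> nat) (a : nat -> 'cV[C]_m) : injective s ->
  (sqsum (a \o s) <= sqsum a)%E.
Proof.
move=> s_inj; rewrite /sqsum.
rewrite -(@esum_image _ _ _ setT s (fun n => (nsq (a n))%:E)); last first.
  by move=> x y _ _; exact: s_inj.
rewrite esum_mkcond; apply: le_esum => n _.
by case: ifP => // _; rewrite lee_fin nsq_ge0.
Qed.

(** [r] is a partial left inverse of the injection [s], along which sequences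
    are pushed forward. *)
Definition push (r : nat -> option nat) (a : nat -> 'cV[C]_m) n : 'cV[C]_m :=
  if r n is Some k then a k else 0.

Lemma sqsum_push (s : nat -> nat) (r : nat -> option nat) a :
  pcancel s r -> (forall n k, r n = Some k -> s k = n) ->
  sqsum (push r a) = sqsum a.
Proof.
move=> sr rs; rewrite /sqsum.
rewrite [RHS](_ : _ = \esum_(n in setT) (nsq (push r a (s n)))%:E); last first.
  by apply: eq_esum => n _; rewrite /push sr.
rewrite -(@esum_image _ _ _ setT s (fun n => (nsq (push r a n))%:E)); last first.
  by move=> x y _ _; exact: (pcan_inj sr).
rewrite [RHS]esum_mkcond; apply: eq_esum => n _.
case: ifPn => //; rewrite notin_setE /push.
case E : (r n) => [k|]; last by rewrite nsq0.
by case; exists k => //; exact: rs.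
Qed.

End coefficients.

(** * The structure of a Wold representation *)

Section shift_from_coefficients.
Context {R : realType} {H : hilbertType R} {m : nat}.
Local Notation C := R[i].
Context {V : {linear H -> H}} {coef : H -> nat -> 'cV[C]_m}.
Hypothesis isoV : isometry_op V.
Hypothesis CO : coefficients V coef.

Lemma sqsum_recl (a : nat -> 'cV[C]_m) :
  sqsum a = ((nsq (a 0%N))%:E + sqsum (a \o succn))%E.
Proof.
have a0 k : (0 <= (nsq (a k))%:E)%E by rewrite lee_fin nsq_ge0.
rewrite /sqsum (esumID [set 0%N]) //.
rewrite setTI esum_set1 //; congr (_ + _)%E.
rewrite -(@esum_image _ _ _ setT succn (fun n => (nsq (a n))%:E)); last first.
  by move=> x y _ _ [].
congr esum; apply/seteqP; split=> [[|n] //= []|_ [n _ <-]] //=.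
by exists n.
Qed.

Lemma coef_norm_le x y : (forall n, nsq (coef x n) <= nsq (coef y n)) -> `|x| <= `|y|.
Proof.
move=> xy; rewrite -(@ler_pXn2r _ 2) ?nnegrE // -!nsqrE lecR -lee_fin.
by rewrite -!(co_norm CO); apply: le_esum => n _; rewrite lee_fin.
Qed.

Lemma norm_eqP (x y : H) : nsqr x = nsqr y -> `|x| = `|y|.
Proof. by move=> xy; apply: (@pexpIrn _ 2) => //; rewrite ?nnegrE // -!nsqrE xy. Qed.

Lemma pullback_operator (s : nat -> nat) : injective s ->
  exists F : {linear H -> H}, forall x n, coef (F x) n = coef x (s n).
Proof.
move=> s_inj; apply: (@coef_operator _ _ _ _ _ CO (fun a => a \o s)) => // a.
exact: sqsum_pullback.
Qed.

Lemma delta_mulE (i j k : 'I_m) (v : 'cV[C]_m) :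
  (delta_mx i j *m v) k 0 = v j 0 *+ (k == i).
Proof.
rewrite mxE (bigD1 j) //= mxE eqxx andbT big1 ?addr0.
  by case: eqP; rewrite (mul1r, mul0r).
by move=> l lj; rewrite mxE (negbTE lj) andbF mul0r.
Qed.

Lemma nsq_delta (i j : 'I_m) (v : 'cV[C]_m) :
  nsq (delta_mx i j *m v : 'cV_m) <= nsq v.
Proof.
rewrite -lecR !nsqE (bigD1 i) //= delta_mulE eqxx mulr1n big1 ?addr0.
  by rewrite (bigD1 j) //= lerDl sumr_ge0 // => k _; rewrite exprn_ge0.
by move=> k ki; rewrite delta_mulE (negbTE ki) normr0 expr0n.
Qed.

Lemma conjC_polar (a b : C) : let N c := `|a + c * b| ^+ 2 in
  4 * (a * b^*) = N 1 - N (- 1) + 'i * (N 'i - N (- 'i)).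
Proof.
have ii : 'i * 'i = -1 :> C by rewrite -expr2 sqrCi.
rewrite /= !normCK !(rmorphD, rmorphN, rmorphM, rmorph1) /= conjCi.
transitivity (2 * (1 - 'i * 'i) * (a * b^*) + 2 * (1 + 'i * 'i) * (b * a^*)).
  by rewrite ii; ring.
ring.
Qed.

(** The inner product splits into those of the constant terms and of the
    backward shifts, and the latter can be iterated until the remainder is
    small; the adjoints are found in this way. *)
Lemma coefficients_vector_shift : exists B e u,
  [/\ vector_shift V B e u, forall x n, coef (B x) n = coef x n.+1 &
      forall i j x n, coef (e i j x) n = delta_mx i j *m coef x n].
Proof.
have [B BE] := pullback_operator succn_inj.
have /choice[e0 e0E] (ij : 'I_m * 'I_m) : exists F : {linear H -> H},
    forall x n, coef (F x) n = delta_mx ij.1 ij.2 *m coef x n.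
  apply: (@coef_operator _ _ _ _ _ CO (fun a n => delta_mx ij.1 ij.2 *m a n)).
    by move=> c a b n /=; rewrite mulmxDr -scalemxAr.
  by move=> a; apply: le_esum => n _; rewrite lee_fin nsq_delta.
pose e i j := e0 (i, j).
have eE i j x n : coef (e i j x) n = delta_mx i j *m coef x n by exact: e0E.
have [Q QE] : exists Q : {linear H -> H}, forall x n,
    coef (Q x) n = if n is _.+1 then 0 else coef x 0%N.
  apply: (@coef_operator _ _ _ _ _ CO (fun a n => if n is _.+1 then 0 else a 0%N)).
    by move=> c a b [|n] //; rewrite scaler0 addr0.
  by move=> a; apply: le_esum => -[|n] _; rewrite lee_fin ?nsq0 ?nsq_ge0.
have /choice[cst cstE] := co_cst CO.
pose u i : H := cst (delta_mx i 0).
exists B, e, u.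
have sum_coef I (r : seq I) (F : I -> H) n :
    coef (\sum_(i <- r) F i) n = \sum_(i <- r) coef (F i) n.
  by elim/big_rec2: _ => [|i y z _ <-]; rewrite ?(coef0 CO) ?(coefD CO).
have nsqr_recl x : nsqr x = nsq (coef x 0%N) + nsqr (B x).
  apply: EFin_inj; rewrite -(co_norm CO) sqsum_recl EFinD -(co_norm CO).
  by congr (_ + esum _ _)%E; apply/funext => n; rewrite BE.
have nsqrQ x : nsqr (Q x) = nsq (coef x 0%N).
  rewrite nsqr_recl QE (_ : B (Q x) = 0) ?/nsqr ?normr0 ?expr0n ?addr0 //.
  by apply: (coef_inj CO) => n; rewrite BE QE (coef0 CO).
have FE (F : {linear H -> H}) (c : C) x y : F x + c *: F y = F (x + c *: y).
  by rewrite linearD linearZ.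
have hdot_recl x y : hdot x y = hdot (Q x) (Q y) + hdot (B x) (B y).
  have nE z : `|z| ^+ 2 = `|Q z| ^+ 2 + `|B z| ^+ 2.
    by rewrite -!nsqrE nsqrQ nsqr_recl rmorphD.
  apply: (@mulfI _ 4); rewrite ?pnatr_eq0 // mulrDr !hdot_polar !FE.
  rewrite !(nE (_ + _)); ring.
have hdotQ x y : hdot (Q x) (Q y) = \sum_k coef x 0%N k 0 * (coef y 0%N k 0)^*.
  apply: (@mulfI _ 4); rewrite ?pnatr_eq0 // hdot_polar mulr_sumr.
  under eq_bigr do rewrite conjC_polar.
  have nE (c : C) : `|Q x + c *: Q y| ^+ 2 =
      \sum_k `|coef x 0%N k 0 + c * coef y 0%N k 0| ^+ 2.
    rewrite FE -nsqrE nsqrQ nsqE; apply: eq_bigr => k _.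
    by rewrite addrC (co_lin CO) !mxE addrC.
  by rewrite !nE big_split /= sumrB -mulr_sumr sumrB.
have QV x : Q (V x) = 0.
  by apply: (coef_inj CO) => -[|n]; rewrite QE (coef0 CO) // (co_V CO).
have BV x : B (V x) = x by apply: (coef_inj CO) => n; rewrite BE (co_V CO).
have VB : adjoint_op V B.
  by move=> x y; rewrite hdot_recl QV hdot0l add0r BV.
have coef_iterB n x k : coef (iter n B x) k = coef x (n + k)%N.
  by elim: n x => // n IHn x; rewrite iterSr IHn BE addSn.
have nsqr_iter n x : nsqr x = \sum_(0 <= k < n) nsq (coef x k) + nsqr (iter n B x).
  elim: n => [|n IHn]; first by rewrite big_geq // add0r.
  rewrite big_nat_recr //= -addrA [LHS]IHn; congr (_ + _).
  by rewrite nsqr_recl coef_iterB addn0.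
have decay x (eps : C) : 0 < eps -> exists n, `|iter n B x| <= eps.
  move=> /complex_gt0P[d d0 ->].
  have [n] := (coef_partial CO x).2 _ (exprn_gt0 2 d0).
  rewrite {1}(nsqr_iter n) addrC addKr => xn; exists n.
  rewrite -(@ler_pXn2r _ 2) ?nnegrE ?lecR ?(ltW d0) // -nsqrE -rmorphXn lecR.
  exact: ltW.
have Be i j x : B (e i j x) = e i j (B x).
  by apply: (coef_inj CO) => n; rewrite BE !eE BE.
have e1 i j x : `|e i j x| <= `|x|.
  by apply: (coef_norm_le) => n; rewrite eE nsq_delta.
have B1 x : `|B x| <= `|x|.
  exact: adjoint_contraction (isometry_contraction isoV) VB x.
have eadj i j : adjoint_op (e i j) (e j i).
  move=> x y; apply/subr0_eq; pose D x y := hdot (e i j x) y - hdot x (e j i y).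
  have DB x' y' : D x' y' = D (B x') (B y').
    rewrite /D [hdot (e i j x') y']hdot_recl [hdot x' _]hdot_recl !Be.
    have -> : hdot (Q (e i j x')) (Q y') = hdot (Q x') (Q (e j i y')).
      rewrite !hdotQ (bigD1 i) //= [RHS](bigD1 j) //= !eE !delta_mulE !eqxx !mulr1n.
      congr (_ + _); rewrite !big1 // => k kj; rewrite delta_mulE (negbTE kj).
        by rewrite mulr0n conjC0 mulr0.
      by rewrite mul0r.
    by rewrite opprD addrACA subrr add0r.
  have Dn n : D x y = D (iter n B x) (iter n B y).
    by elim: n => //= n ->; exact: DB.
  apply: (@norm_small_eq0 _ C^o _ (2 * `|y|)); first by rewrite mulr_ge0.
  move=> eps /(decay x)[n xn]; rewrite -/(D x y) (Dn n).
  have yn : `|iter n B y| <= `|y|.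
    by elim: n {xn} => //= n IHn; apply: le_trans (B1 _) IHn.
  apply: le_trans (ler_normB _ _) _; rewrite -mulrA mulr_natl mulr2n.
  rewrite (mulrC `|y|); apply: lerD; apply: le_trans (cauchy_schwarz _ _) _.
    by apply: ler_pM => //; apply: le_trans (e1 _ _ _) xn.
  by apply: ler_pM => //; apply: le_trans (e1 _ _ _) yn.
split=> //; split.
- split=> //; first split=> //.
  + move=> i j k l x; apply: (coef_inj CO) => n; rewrite !eE mulmxA mul_delta_mx_cond.
    by case: eqP => _; rewrite ?mulr1n ?mulr0n ?eE // (coef0 CO) mul0mx.
  + move=> x; apply: (coef_inj CO) => n; rewrite sum_coef.
    under eq_bigr do rewrite eE.
    rewrite -mulmx_suml -[RHS]mul1mx scalar_mx_sum_delta; congr (_ *m _).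
    by apply: eq_bigr => i _; rewrite scale1r.
  + move=> i j x; apply: (coef_inj CO) => n; rewrite eE !(co_V CO).
    by case: n => [|n]; rewrite ?mulmx0 ?eE.
- exact: decay.
- move=> x Bx; exists (fun i => coef x 0%N i 0); apply: (coef_inj CO) => n.
  rewrite sum_coef; under eq_bigr => i _.
    rewrite -[_ *: _]addr0 (co_lin CO) (coef0 CO) addr0 cstE; over.
  case: n => [|n]; last first.
    by rewrite -BE Bx (coef0 CO) big1 // => i _; rewrite scaler0.
  by rewrite {1}(matrix_sum_delta (coef x 0%N)) exchange_big big_ord1.
- by move=> i; apply: (coef_inj CO) => n; rewrite BE cstE (coef0 CO).
- move=> i j k; apply: (coef_inj CO) => n; rewrite eE cstE.
  case: n => [|n]; rewrite ?mulmx0; last first.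
    by case: eqP => _; rewrite ?mulr1n ?mulr0n ?cstE ?(coef0 CO).
  rewrite mul_delta_mx_cond; case: eqP => _; rewrite ?mulr1n ?mulr0n ?cstE //.
  by rewrite (coef0 CO).
- move=> i; apply/eqP => ui; have := cstE (delta_mx i 0) 0%N.
  rewrite -/(u i) ui (coef0 CO) => /matrixP/(_ i 0); rewrite !mxE !eqxx /=.
  by move/esym/eqP; rewrite oner_eq0.
Qed.

End shift_from_coefficients.

(** * The bilateral shift *)

Section bilateral_shift.
Context {R : realType} {H : hilbertType R} {m : nat}.
Local Notation C := R[i].
Context {V B : {linear H -> H}} {coef : H -> nat -> 'cV[C]_m}.
Context {e : 'I_m -> 'I_m -> {linear H -> H}} {u : 'I_m -> H}.
Hypothesis CO : coefficients V coef.
Hypothesis VS : vector_shift V B e u.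
Hypothesis BE : forall x n, coef (B x) n = coef x n.+1.
Hypothesis eE : forall i j x n, coef (e i j x) n = delta_mx i j *m coef x n.

(** The integers are coded as natural numbers, [k >= 0] by [2 k] and [- k - 1]
    by [2 k + 1]; then [zpred] is the predecessor and [zsucc] the successor. *)
Definition zpred n := if odd n then n.+2 else if n == 0%N then 1%N else n.-2.
Definition zsucc n := if odd n then (if n == 1%N then 0%N else n.-2) else n.+2.

Lemma zpredK : cancel zpred zsucc.
Proof.
move=> [|[|n]] //; rewrite /zpred /zsucc /= ?negbK.
by case on : (odd n); rewrite /= ?negbK ?on.
Qed.

Lemma zsuccK : cancel zsucc zpred.
Proof.
move=> [|[|n]] //; rewrite /zpred /zsucc /= ?negbK.
by case on : (odd n); rewrite /= ?negbK ?on.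
Qed.

(** The partial inverse of the coding [n |-> 2 n] of the nonnegative integers. *)
Definition half_opt n := if odd n then None else Some n./2.

(** The bilateral shift of multiplicity [m], with an isometric embedding of the
    unilateral one; the sequences indexed by the integers are reindexed by the
    natural numbers, so that the space is [H] itself. *)
Lemma bilateral_shift : exists W W' J : {linear H -> H},
  [/\ matrix_isometry W W' e, forall x, W (W' x) = x, isometry_op J,
      forall x, W (J x) = J (V x) &
      (forall i j x, J (e i j x) = e i j (J x)) /\
      (forall (c : C) x, W x = c *: x -> x = 0)].
Proof.
have [W WE] := pullback_operator CO (can_inj zpredK).
have [W' W'E] := pullback_operator CO (can_inj zsuccK).
have pushE a : sqsum (push half_opt a) = sqsum (a : nat -> 'cV[C]_m).
  apply: (@sqsum_push _ _ double).
    by move=> n; rewrite /half_opt odd_double doubleK.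
  move=> n k; rewrite /half_opt; case: ifP => // on [<-].
  by rewrite -[RHS]odd_double_half on.
have [J JE] : exists J : {linear H -> H}, forall x n,
    coef (J x) n = push half_opt (coef x) n.
  apply: (@coef_operator _ _ _ _ _ CO (push half_opt)) => [c a b n|a].
    by rewrite /push; case: (half_opt n) => //; rewrite scaler0 addr0.
  by rewrite pushE.
have W'W x : W' (W x) = x.
  by apply: (coef_inj CO) => n; rewrite W'E WE zsuccK.
have WW' x : W (W' x) = x.
  by apply: (coef_inj CO) => n; rewrite WE W'E zpredK.
have pullback_le (F : {linear H -> H}) s : injective s ->
    (forall x n, coef (F x) n = coef x (s n)) -> forall x, `|F x| <= `|x|.
  move=> s_inj FE x; rewrite -(@ler_pXn2r _ 2) ?nnegrE // -!nsqrE lecR -lee_fin.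
  rewrite -!(co_norm CO); apply: le_trans (sqsum_pullback (coef x) s_inj).
  by apply: le_esum => n _; rewrite /= FE.
have isoW : isometry_op W.
  move=> x; apply/le_anti/andP; split.
    exact: pullback_le (can_inj zpredK) WE x.
  by rewrite -{1}(W'W x); exact: pullback_le (can_inj zsuccK) W'E _.
exists W, W', J; split=> //.
- split=> //.
  + by move=> x y; rewrite -{1}(WW' y) (isometry_hdot isoW).
  + exact: mi_units (vs_isometry VS).
  + by move=> i j x; apply: (coef_inj CO) => n; rewrite eE !WE eE.
- move=> x; apply: norm_eqP; apply: EFin_inj; rewrite -!(co_norm CO) -(pushE (coef x)).
  by apply: eq_esum => n _; rewrite JE.
- move=> x; apply: (coef_inj CO) => n; rewrite WE !JE /push /half_opt /zpred.
  case on : (odd n); first by rewrite /= on.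
  case: n on => [|[|n]] //=; first by rewrite (co_V CO).
  by rewrite negbK => ->; rewrite (co_V CO).
split=> [i j x|c x Wx].
  apply: (coef_inj CO) => n; rewrite eE !JE /push.
  by case: (half_opt n) => [k|]; rewrite ?eE ?mulmx0.
have [//|x0] := eqVneq x 0.
have c1 : `|c| = 1.
  have := isoW x; rewrite Wx normrZ -{2}[`|x|]mul1r => /mulIf -> //.
  by rewrite normr_eq0.
(* The coefficients of an eigenvector have constant norm along each half of
   the integers, which contradicts their square summability. *)
have step n : nsq (coef x n.+2) = nsq (coef x n).
  apply: (@complexI R); case on : (odd n).
    have := congr1 (fun z => coef z n) Wx; rewrite WE /zpred on => ->.
    by rewrite -[c *: x]addr0 (co_lin CO) (coef0 CO) addr0 nsqZ c1 expr1n mul1r.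
  have := congr1 (fun z => coef z n.+2) Wx; rewrite WE /zpred /= negbK on /= => ->.
  by rewrite -[c *: x]addr0 (co_lin CO) (coef0 CO) addr0 nsqZ c1 expr1n mul1r.
apply: (coef_inj CO) => n; rewrite (coef0 CO); apply/nsq_eq0/(@complexI R).
have s_inj : injective (fun k => (n + k.*2)%N).
  by move=> k l /eqP; rewrite eqn_add2l -!muln2 eqn_mul2r => /eqP.
have [F FE] := pullback_operator CO s_inj.
have const k : nsq (coef x (n + k.*2)%N) = nsq (coef x n).
  by elim: k => [|k IHk]; rewrite ?addn0 // doubleS !addnS step.
have iterB k z l : coef (iter k B z) l = coef z (k + l)%N.
  by elim: k z => // k IHk z; rewrite iterSr IHk BE addSn.
have v0 : 0 <= (nsq (coef x n))%:C%C :> C by rewrite lecR nsq_ge0.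
have small (eps : C) : 0 < eps -> (nsq (coef x n))%:C%C <= eps ^+ 2.
  move=> e0; have [k xk] := vs_decay VS (F x) e0.
  rewrite -(const k) -FE -[k in coef _ k]addn0 -iterB.
  apply: (@le_trans _ _ (nsqr (iter k B (F x)))%:C%C).
    by rewrite lecR; exact: (nsq_coef CO).
  by rewrite nsqrE ler_pXn2r ?nnegrE ?(ltW e0).
apply: (@norm_small_eq0 _ C^o _ 1) => // eps e0; rewrite mul1r ger0_norm //.
have e1 : 0 < 1 + eps by rewrite addr_gt0.
have d0 : 0 < eps / (1 + eps) by rewrite divr_gt0.
apply: le_trans (small _ d0) _; rewrite expr2.
apply: (@le_trans _ _ (eps / (1 + eps))).
  by rewrite ler_piMl ?(ltW d0) // ler_pdivrMr // mul1r lerDr.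
by rewrite ler_pdivrMr // ler_peMr ?(ltW e0) // lerDl ltW.
Qed.

End bilateral_shift.

(** * Polynomials on the disc and on the circle *)

Section circle.
Context {R : realType} {m : nat}.
Local Notation C := R[i].

(** The points [1 / (k + 2)] are too many to be all zeros of [p]. *)
Lemma nonroot_disc (p : {poly C}) : p != 0 -> exists2 t : C, `|t| < 1 & p.[t] != 0.
Proof.
move=> p0; pose s := [seq (k.+2%:R^-1 : C) | k <- iota 0 (size p)].
have us : uniq s.
  rewrite map_inj_uniq ?iota_uniq // => k l /invr_inj/eqP.
  by rewrite eqr_nat !eqSS => /eqP.
case: (boolP (all (root p) s)) => [roots|/allPn[t]].
  by have := max_poly_roots p0 roots us; rewrite size_map size_iota ltnn.
move=> /mapP[k _ ->] rt; exists (k.+2%:R^-1) => //.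
by rewrite ger0_norm ?invr_ge0 // invf_lt1 ?ltr0n // ltr1n.
Qed.

(** The half circle [0 <= x <= pi], on which [acos] recovers the argument, is
    not covered by a null set and finitely many points. *)
Lemma ae_circle_eq0 (p : {poly C}) :
  {ae (@lebesgue_measure R), forall x : R, 0 <= x <= pi *+ 2 ->
    p.[Complex (cos x) (sin x)] = 0} -> p = 0.
Proof.
move=> [A [mA A0 pA]]; apply/eqP; apply: contraT => p0.
have [rs rsE] : exists rs : seq C, forall z, root p z -> z \in rs.
  have [rs ->] := closed_field_poly_normal p; exists rs => z.
  by rewrite rootZ ?lead_coef_eq0 // root_prod_XsubC.
pose F := [set` [seq acos (complex.Re z) | z <- rs]].
have F0 : lebesgue_measure (F : set R) = 0%E.
  by apply/countable_lebesgue_measure0/finite_set_countable/finite_seq.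
have mF : measurable (F : set (measurableTypeR R)).
  by apply: countable_measurable => //; apply/finite_set_countable/finite_seq.
have sub : (`[0, pi]%classic : set R) `<=` A `|` F.
  move=> x; rewrite /= in_itv /= => /andP[x0 xpi].
  have [xA|xA] := pselect (A x); [by left|right].
  have px : p.[Complex (cos x) (sin x)] = 0.
    have := contra_not (pA x) xA; rewrite /= notK; apply.
    rewrite x0 /= (le_trans xpi) // mulr2n lerDl pi_ge0.
    by [].
  apply/mapP; exists (Complex (cos x) (sin x)); first exact/rsE/rootP.
  by rewrite /= cosK // in_itv /= x0.
have := @lebesgue_measure_itv R `[0, pi]; rewrite /= lte_fin pi_gt0.
rewrite -EFinD subr0 => mI.
suff : (pi%:E <= 0 :> \bar R)%E by rewrite lee_fin leNgt pi_gt0.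
rewrite -mI; apply: (@le_trans _ _ (lebesgue_measure (A `|` F))).
  by apply: le_measure; rewrite ?inE //; exact: measurableU.
apply: (@le_trans _ _ (lebesgue_measure A + lebesgue_measure F)%E).
  exact: measureU2.
by rewrite A0 F0 adde0.
Qed.

Lemma circle_norm (x : R) : `|Complex (cos x) (sin x)| = 1 :> C.
Proof. by rewrite normc_def cos2Dsin2 sqrtr1. Qed.

Definition horner_mxE (P : 'M[{poly C}]_m) (t : C) : 'M[C]_m := map_mx (horner^~ t) P.

Lemma horner_mxrevconj d (P : 'M[{poly C}]_m) (t : C) : `|t| = 1 ->
  (forall i j, (size (P i j) <= d.+1)%N) ->
  horner_mxE (mxrevconj d P) t = t ^+ d *: ((horner_mxE P t)^t*)%sesqui.
Proof.
move=> t1 Pd; have t0 : t != 0 by rewrite -normr_gt0 t1.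
apply/matrixP => i j; rewrite !mxE horner_revconj //.
suff -> : (t^-1)^* = t by [].
by rewrite invC_norm t1 expr1n invr1 mul1r conjCK.
Qed.

Lemma normal_circle d (P : 'M[{poly C}]_m) (t : C) : `|t| = 1 ->
  (forall i j, (size (P i j) <= d.+1)%N) ->
  (horner_mxE P t \is normalmx) =
  (horner_mxE (P *m mxrevconj d P - mxrevconj d P *m P) t == 0).
Proof.
move=> t1 Pd; have t0 : t ^+ d != 0 by rewrite expf_neq0 // -normr_gt0 t1.
have rm A : horner_mxE A t = map_mx (horner_eval t) A by [].
rewrite [X in _ = (X == _)]rm map_mxB !map_mxM -!rm horner_mxrevconj //.
rewrite -scalemxAr -scalemxAl.
by rewrite subr_eq0 (inj_eq (scalerI t0)); apply/normalmxP/eqP.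
Qed.

Lemma disc_unit_lower_bound (q : {poly C}) : disc_unit q ->
  exists2 M : C, 0 <= M & forall t, `|t| < 1 -> `|q.[t]|^-1 <= M.
Proof.
move=> q1; have q0 := disc_unit_neq0 q1.
have [r [qE]] := disc_unit_factor q1.
rewrite qE; move: (lead_coef q) => c {q0 q1 qE}; elim: r => [|z r IHr] r1.
  by exists `|c|^-1 => [|t _]; rewrite ?invr_ge0 // big_nil alg_polyC hornerC.
have [w wr|M M0 Mq] := IHr; first by apply: r1; rewrite inE wr orbT.
have z1 : 0 < `|z| - 1 by rewrite subr_gt0 r1 ?mem_head.
exists ((`|z| - 1)^-1 * M) => [|t t1]; first by rewrite mulr_ge0 // invr_ge0 ltW.
rewrite big_cons scalerAr hornerM hornerXsubC normrM invfM ler_pM ?invr_ge0 ?Mq //.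
rewrite lef_pV2 ?posrE //; last first.
  rewrite normr_gt0 subr_eq0; apply: contraTneq t1 => ->.
  by rewrite -real_leNgt ?normr_real // ltW // -subr_gt0.
by rewrite distrC; apply: le_trans (lerB_dist _ _); rewrite lerD2l lerN2 ltW.
Qed.

Lemma poly_disc_bound (p : {poly C}) :
  exists2 M : C, 0 <= M & forall t, `|t| < 1 -> `|p.[t]| <= M.
Proof.
exists (\sum_(i < size p) `|p`_i|) => [|t t1]; first exact: sumr_ge0.
rewrite horner_coef; apply: le_trans (ler_norm_sum _ _ _) _; apply: ler_sum => i _.
by rewrite normrM normrX ler_piMr // exprn_ile1 // ltW.
Qed.

End circle.

(** * Subnormality in terms of polynomial symbols *)

Section normal_symbols.
Context {R : realType} {H : hilbertType R} {m : nat}.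
Local Notation C := R[i].
Context {V B : {linear H -> H}} {e : 'I_m -> 'I_m -> {linear H -> H}}.
Context {u : 'I_m -> H}.
Hypothesis VS : vector_shift V B e u.

(** The class NDARN in terms of polynomials: the three conditions on [P / q]
    become that [q] has no zeros in the closed disc, that [P] and [P~] commute
    and that no [P - c q] is singular. The common degree bound [d] enters the
    definition of [P~]. *)
Record normal_symbol (d : nat) (q : {poly C}) (P : 'M[{poly C}]_m) : Prop :=
NormalSymbol {
  ns_unit : disc_unit q;
  ns_size : (size q <= d.+1)%N;
  ns_mxsize : forall i j, (size (P i j) <= d.+1)%N;
  ns_normal : P *m mxrevconj d P = mxrevconj d P *m P;
  ns_det : forall c, \det (P - (c *: q)%:M) != 0
}.

Lemma common_size (q : {poly C}) (P : 'M[{poly C}]_m) :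
  exists d, (size q <= d.+1)%N /\ forall i j, (size (P i j) <= d.+1)%N.
Proof.
exists (size q + \sum_i \sum_j size (P i j))%N; split=> [|i j].
  by rewrite ltnW // ltnS leq_addr.
rewrite ltnW // ltnS (leq_trans _ (leq_addl _ _)) //.
by rewrite (bigD1 i) //= (bigD1 j) //= -addnA leq_addr.
Qed.

Lemma subnormal_symbol (S : {linear H -> H}) : bounded_op S ->
  (forall x, S (V x) = V (S x)) -> without_point_masses S ->
  finite_rank_self_commutator S ->
  exists d q P, normal_symbol d q P /\ has_symbol (T := V) (e := e) S q P.
Proof.
move=> Sb SV [K [J [N [[isoJ Nb [N0 [_ NN0] normalN] NJ] noeig]]]].
move=> [S0 [_ SS0] [n [f fP]]].
have SS0' : adjoint_op S S0 by move=> x y; exact: SS0.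
have [S' S'E] := adjoint_linear SS0'.
have SS' : adjoint_op S S' by move=> x y; rewrite S'E SS0.
have NN' : adjoint_op N N0 by move=> x y; exact: NN0.
have {}normalN x : N (N0 x) = N0 (N x) by exact: normalN.
have rankD x : lin_span f (S' (S x) - S (S' x)).
  by rewrite !S'E; apply: fP; exists x.
have [q0 [P0 [q00 SP0]]] := operator_rational VS Sb SS' SV isoJ NJ NN' normalN rankD.
have [q [P [q1 SP]]] := symbol_reduce VS q00 SP0.
have [d [qd Pd]] := common_size q P.
exists d, q, P; split=> //; split=> //.
  exact: (symbol_normal VS SS' SV isoJ NJ NN' normalN rankD q1 qd Pd SP).
move=> c; apply/eqP => /(symbol_eigenvector VS q1 SP)[x /negP x0 Sx]; apply: x0.
have /noeig Jx : N (J x) = c *: J x by rewrite NJ Sx linearZ.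
by rewrite -normr_eq0 -isoJ Jx normr0.
Qed.

End normal_symbols.

Section no_eigenvectors.
Context {R : realType} {H : hilbertType R} {m : nat}.
Local Notation C := R[i].

(** Multiplying by the adjugate of [P - c q] turns an eigenvector into a zero
    of a nonzero polynomial in [W]. *)
Lemma symbol_no_eigenvector (W W' N : {linear H -> H})
    (e : 'I_m -> 'I_m -> {linear H -> H}) q (P : 'M[{poly C}]_m) (c : C) x :
  matrix_isometry W W' e -> (forall (c : C) x, W x = c *: x -> x = 0) ->
  has_symbol (T := W) (e := e) N q P -> \det (P - (c *: q)%:M) != 0 ->
  N x = c *: x -> x = 0.
Proof.
move=> MW noeig NP det0 Nx; have [//|x0] := eqVneq x 0.
have [emul eone _] := mi_units MW; have eW := mi_comm MW.
have [c' [y [/negP y0 Wy]]] : exists c y, y != 0 /\ W y = c *: y.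
  apply: (opoly_eigenvector det0 x0).
  rewrite -(mxop_scalar W eone) -mul_adj_mx mxopM // mxopB // mxop_scalar //.
  by rewrite -NP Nx opolyZ linearZ subrr linear0.
by case: y0; apply/eqP/(noeig c').
Qed.

End no_eigenvectors.

Section symbols_to_subnormal.
Context {R : realType} {H : hilbertType R} {m : nat}.
Local Notation C := R[i].
Context {V B : {linear H -> H}} {e : 'I_m.+1 -> 'I_m.+1 -> {linear H -> H}}.
Context {u : 'I_m.+1 -> H}.
Hypothesis VS : vector_shift V B e u.
Context {W W' J : {linear H -> H}}.
Hypothesis MW : matrix_isometry W W' e.
Hypothesis WK : forall x, W (W' x) = x.
Hypothesis isoJ : isometry_op J.
Hypothesis WJ : forall x, W (J x) = J (V x).
Hypothesis eJ : forall i j x, J (e i j x) = e i j (J x).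
Hypothesis noeig : forall (c : C) x, W x = c *: x -> x = 0.

(** The normal extension is [N = q(W)^-1 P(W)], where [W] is the bilateral shift
    that extends [V]. *)
Lemma symbol_subnormal (S : {linear H -> H}) d q (P : 'M[{poly C}]_m.+1) :
  normal_symbol d q P -> has_symbol (T := V) (e := e) S q P ->
  [/\ subnormal S, pure_op S, without_point_masses S, finite_type S &
      forall x, S (V x) = V (S x)].
Proof.
move=> [q1 qd Pd PP det0] SP.
have MV := vs_isometry VS.
have [N [N' [[M NM] NN' NP]]] := symbol_operator MW P q1.
have [S1 [S' [_ S1S' S1P]]] := symbol_operator MV P q1.
have SS' : adjoint_op S S'.
  move=> x y; rewrite -S1S'; congr hdot.
  by apply: (opoly_disc_unit_inj MV q1); rewrite SP S1P.
have opJ p x : opoly W p (J x) = J (opoly V p x).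
  rewrite /opoly linear_sum; apply: eq_bigr => i _; rewrite linearZ /=.
  congr (_ *: _); elim: (i : nat) => //= n ->; exact: WJ.
have NJ x : N (J x) = J (S x).
  apply: (opoly_disc_unit_inj MW q1); rewrite NP opJ SP /mxop !linear_sum.
  apply: eq_bigr => i _; rewrite linear_sum; apply: eq_bigr => j _.
  by rewrite -eJ opJ.
have normalN x : N (N' x) = N' (N x).
  have [z <-] := revconj_opoly_surj MW q1 qd WK x.
  by rewrite (symbol_self_commutator MW q1 qd Pd PP NP NN').
have NW := symbol_shift_comm MW q1 NP.
have N'W x : N' (W x) = W (N' x).
  have W'N' := adjoint_comm NN' (mi_adjoint MW) NW.
  have W'K y : W' (W y) = y := isometry_left_inverse (mi_isometry MW) (mi_adjoint MW) y.
  by rewrite -[LHS]WK -W'N' W'K.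
have noeigN (c : C) x : N x = c *: x -> x = 0.
  exact: (symbol_no_eigenvector MW noeig NP (det0 c)).
have ext : normal_extension S J N.
  split=> //; first by exists M.
  by exists N' => //; split=> // x y _ _; exact: NN'.
have sub : subnormal S by exists H, J, N.
have pureS : pure_op S.
  have N'b : bounded_op N' by exists M; exact: (adjoint_bound NN' NM).
  exact: (symbol_pure MV (vs_decay VS) q1 SP isoJ NJ NN' normalN N'b
    WJ N'W noeigN).
have SV := symbol_shift_comm MV q1 SP.
split=> //; first by exists H, J, N.
split=> //; exists S'; first by split=> // x y _ _; exact: SS'.
exact: (symbol_finite_rank MV (vs_ker VS) q1 qd Pd PP SP SS').
Qed.

End symbols_to_subnormal.

(** * Toeplitz operators with rational symbols *)

Section evaluation.
Context {R : realType} {H : hilbertType R} {m : nat}.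
Local Notation C := R[i].
Context {V : {linear H -> H}} {U : {linear H -> (disc R -> 'cV[C]_m)}}.
Context {coef : H -> nat -> 'cV[C]_m}.
Context {e : 'I_m -> 'I_m -> {linear H -> H}}.
Hypothesis KW : kolmogorov_wold V U.
Hypothesis UC : forall x, taylor (U x) (coef x).
Hypothesis eE : forall i j x n, coef (e i j x) n = delta_mx i j *m coef x n.

Lemma kw_inj : injective U.
Proof. by move=> x y; have [_ inj _] := kw_bij KW; apply: inj; rewrite inE. Qed.

Lemma kw_surj f : H2 R m f -> exists x, f = U x.
Proof. by have [_ _ surj] := kw_bij KW; move=> /surj[x _ <-]; exists x. Qed.

Lemma kw_H2 x : H2 R m (U x).
Proof. by exists (`|x| ^+ 2); exact: kw_isometry KW x. Qed.

Lemma conj_opE (T : H -> H) x : conj_op U T (U x) = U (T x).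
Proof. by rewrite /conj_op /= pinvKV ?inE // => y z _ _; exact: kw_inj. Qed.

Lemma eval_shift x t : U (V x) t = val t *: U x t.
Proof. by rewrite -conj_opE (kw_shift KW (kw_H2 x)). Qed.

(** Matrix units were defined on Taylor coefficients, hence act pointwise. *)
Lemma eval_matrix_unit i j x t : U (e i j x) t = delta_mx i j *m U x t.
Proof.
have hC : hausdorff_space C^o by exact: norm_hausdorff.
apply/colP => k; rewrite delta_mulE; have := @UC (e i j x) t k.
under eq_fun do rewrite eE delta_mulE.
case: eqP => _ /= h; first exact: (cvg_unique hC h (@UC x t j)).
apply: (cvg_unique hC h); rewrite mulr0n (_ : series _ = fun=> 0).
  exact: cvg_cst.
by apply/funext => n; rewrite /series /= big1 // => l _; rewrite mul0r.
Qed.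

Lemma eval_opoly p x t : U (opoly V p x) t = p.[val t] *: U x t.
Proof.
elim/poly_ind: p => [|p c IHp].
  by rewrite opoly0 linear0 horner0 scale0r.
rewrite opolyD opolyMX opolyC hornerMXaddC linearD linearZ /=.
by rewrite -[LHS]/(U (V _) t + c *: U x t) eval_shift IHp scalerA -scalerDl mulrC.
Qed.

Lemma eval_mxop P x t : U (mxop V e P x) t = horner_mxE P (val t) *m U x t.
Proof.
rewrite linear_sum fct_sumE [in RHS](matrix_sum_delta (horner_mxE P _)) mulmx_suml.
apply: eq_bigr => i _; rewrite linear_sum fct_sumE mulmx_suml; apply: eq_bigr => j _.
by rewrite eval_opoly eval_matrix_unit mxE scalemxAl.
Qed.

Lemma has_symbolP (S : {linear H -> H}) q (P : 'M[{poly C}]_m) :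
  has_symbol (T := V) (e := e) S q P <->
  forall x t, q.[val t] *: U (S x) t = horner_mxE P (val t) *m U x t.
Proof.
split=> SP x => [t|]; first by rewrite -eval_opoly SP eval_mxop.
by apply: kw_inj; apply/funext => t; rewrite eval_opoly eval_mxop.
Qed.

Lemma toeplitzP (S : {linear H -> H}) F :
  (forall f, H2 R m f -> conj_op U S f = toeplitz F f) <->
  forall x t, U (S x) t = mx_eval F (val t) *m U x t.
Proof.
split=> SF => [x t|f /kw_surj[x ->]].
  by rewrite -conj_opE SF //; exact: kw_H2.
by rewrite conj_opE; apply/funext => t; exact: SF.
Qed.

End evaluation.

Lemma derivable_poly {K : numFieldType} (p : {poly K}) (t : K) :
  derivable (fun z : K^o => p.[z] : K^o) t 1.
Proof.
elim/poly_ind: p => [|p c IHp].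
  rewrite (_ : (fun z => _) = fun=> 0); first exact: derivable_cst.
  by apply/funext => z; rewrite horner0.
pose f (z : K^o) : K^o := p.[z]; pose g (z : K^o) : K^o := z.
pose h (z : K^o) : K^o := c.
have dg : derivable g t 1 by exact: derivable_id.
have dh : derivable h t 1 by exact: derivable_cst.
have fg := @derivableM K K^o f g _ _ IHp dg.
have fgh := @derivableD _ _ _ (f * g) h _ _ fg dh.
rewrite (_ : (fun z => _) = f * g + h) //.
by apply/funext => z; rewrite hornerMXaddC.
Qed.
Lemma derivable_frac {K : numFieldType} (p q : {poly K}) (t : K) : q.[t] != 0 ->
  derivable (fun z : K^o => p.[z] / q.[z] : K^o) t 1.
Proof.
move=> qt0; pose f (z : K^o) : K^o := p.[z]; pose g (z : K^o) : K^o := q.[z].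
have dg := @derivableV K K^o g t 1 qt0 (@derivable_poly _ q t).
exact: (@derivableM K K^o f (fun z => (g z)^-1) _ _ (@derivable_poly _ p t) dg).
Qed.

Section fractions.
Context {R : realType} {m : nat}.
Local Notation C := R[i].
Implicit Types (p q : {poly C}) (P : 'M[{poly C}]_m) (F : 'M[{fraction {poly C}}]_m).

Definition mxfrac q P : 'M[{fraction {poly C}}]_m :=
  \matrix_(i, j) (FracField.tofrac (P i j) / FracField.tofrac q).

Lemma mxfrac_eval q P t : q.[t] != 0 ->
  mx_defined (mxfrac q P) t /\ mx_eval (mxfrac q P) t = q.[t]^-1 *: horner_mxE P t.
Proof.
move=> qt0; split=> [i j|].
  by rewrite mxE; have [] := frac_evalE (P i j) qt0.
apply/matrixP => i j; rewrite !mxE; have [_ ->] := frac_evalE (P i j) qt0.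
exact: mulrC.
Qed.

Lemma normalmxZ (A : 'M[C]_m) (c : C) : A \is normalmx -> c *: A \is normalmx.
Proof.
move=> /normalmxP AA; apply/normalmxP; rewrite linearZ /= map_mxZ.
by rewrite -!scalemxAl -!scalemxAr AA !scalerA mulrC.
Qed.

Lemma horner_mxE_det P (q : {poly C}) (c t : C) :
  (\det (P - (c *: q)%:M)).[t] = \det (horner_mxE P t - (c * q.[t])%:M).
Proof.
rewrite -[LHS]/(horner_eval t _) -det_map_mx map_mxB map_scalar_mx /=.
by rewrite /horner_eval hornerZ.
Qed.

(** On the circle, where [q] has no zeros, [P / q] is normal at every point. *)
Lemma normal_symbol_NDARN d q P : normal_symbol d q P -> NDARN (mxfrac q P).
Proof.
move=> [q1 qd Pd PP det0].
have qt t : `|t| <= 1 -> q.[t] != 0 by exact: q1.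
split.
- split=> [t t1|].
    have [Ft _] := mxfrac_eval P (qt _ (ltW t1)); split=> // i j.
    exact: derivable_frac (Ft i j).
  have [M M0 qM] := disc_unit_lower_bound q1.
  have /choice[b bP] (ij : 'I_m * 'I_m) : exists b : C, 0 <= b /\
      forall t, `|t| < 1 -> `|(P ij.1 ij.2).[t]| <= b.
    by have [b b0 Pb] := poly_disc_bound (P ij.1 ij.2); exists b.
  exists (M * \sum_ij b ij) => t t1 i j.
  rewrite (mxfrac_eval P (qt _ (ltW t1))).2 !mxE normrM normfV.
  apply: ler_pM => //; first exact: qM.
  apply: le_trans ((bP (i, j)).2 _ t1) _.
  by rewrite (bigD1 (i, j)) //= lerDl sumr_ge0 // => ij _; exact: (bP ij).1.
- apply: aeW => x _ /=; set t := Complex _ _.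
  have t1 : `|t| = 1 by exact: circle_norm.
  have [|Ft ->] := mxfrac_eval P (t := t) (q := q); first by rewrite qt ?t1.
  split=> //.
  apply: normalmxZ; rewrite (normal_circle t1 Pd) PP subrr.
  by apply/eqP/matrixP => i j; rewrite !mxE horner0.
move=> c; have [t t1 dt] := nonroot_disc (det0 c); exists t => //.
have qt0 := qt _ (ltW t1); rewrite (mxfrac_eval P qt0).2.
rewrite (_ : _ - _ = q.[t]^-1 *: (horner_mxE P t - (c * q.[t])%:M)); last first.
  by rewrite scalerBr scale_scalar_mx mulrC mulfK.
by rewrite detZ mulf_neq0 ?expf_neq0 ?invr_eq0 // -horner_mxE_det.
Qed.

Definition mxden F : {poly C} := \prod_i \prod_j frac_den (F i j).

Definition mxnum F : 'M[{poly C}]_m :=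
  \matrix_(i, j) (frac_num (F i j) * (mxden F %/ frac_den (F i j))).

Lemma mxden_defined F t : mx_defined F t -> (mxden F).[t] != 0.
Proof.
move=> Ft; rewrite horner_prod; apply/prodf_neq0 => i _.
by rewrite horner_prod; apply/prodf_neq0 => j _; exact: Ft.
Qed.

Lemma mxnum_eval F t : mx_defined F t ->
  horner_mxE (mxnum F) t = (mxden F).[t] *: mx_eval F t.
Proof.
move=> Ft; apply/matrixP => i j; rewrite !mxE hornerM /frac_eval.
have dF : frac_den (F i j) %| mxden F.
  rewrite /mxden (bigD1 i) //= dvdp_mulr // (bigD1 j) //= dvdp_mulr //.
by rewrite -[X in _ = X.[t] * _](divpK dF) hornerM mulrACA divff ?Ft // mulr1 mulrC.
Qed.

End fractions.

Section toeplitz_to_symbols.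
Context {R : realType} {H : hilbertType R} {m : nat}.
Local Notation C := R[i].
Context {V B : {linear H -> H}} {e : 'I_m -> 'I_m -> {linear H -> H}}.
Context {u : 'I_m -> H}.
Hypothesis VS : vector_shift V B e u.

(** A matrix polynomial is determined by its operator, so that two fractions
    which represent the same operator are equal. *)
Lemma has_symbol_proportional (S : {linear H -> H}) q P q1 P1 :
  has_symbol (T := V) (e := e) S q P -> has_symbol (T := V) (e := e) S q1 P1 ->
  q%:M *m P1 = q1%:M *m P.
Proof.
move=> SP SP1; have MV := vs_isometry VS.
have [emul eone _] := mi_units MV; have eV := mi_comm MV.
apply/subr0_eq/(mxop_eq0 VS) => j.
by rewrite mxopB !mxopM // !mxop_scalar // -SP -SP1 -!opolyM mulrC subrr.
Qed.

(** On the circle the values of [P / q] agree with those of [F] off the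
    poles, so the polynomial identity expressing normality holds almost
    everywhere. *)
Lemma NDARN_normal_symbol (S : {linear H -> H}) F : NDARN F ->
  has_symbol (T := V) (e := e) S (mxden F) (mxnum F) ->
  exists d q P, normal_symbol d q P /\ has_symbol (T := V) (e := e) S q P.
Proof.
move=> [[Fan _] Fnormal Fdeg] SF.
have F0 : mxden F != 0.
  have := mxden_defined (Fan 0 _).1; rewrite normr0 ltr01 => /(_ isT).
  by apply: contraNneq => ->; rewrite horner0.
have [q [P [q1 SP]]] := symbol_reduce VS F0 SF.
have [d [qd Pd]] := common_size q P.
have PE t : mx_defined F t -> horner_mxE P t = q.[t] *: mx_eval F t.
  move=> Ft; have := congr1 (horner_mxE^~ t) (has_symbol_proportional SF SP).
  rewrite !mul_scalar_mx => h; apply: (scalerI (mxden_defined Ft)).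
  rewrite scalerA mulrC -scalerA -mxnum_eval //.
  by apply/matrixP => i j; move/matrixP/(_ i j): h; rewrite !mxE !hornerM.
exists d, q, P; split=> //; split=> //.
- apply/subr0_eq/matrixP => i j; rewrite [RHS]mxE; apply: ae_circle_eq0.
  have [A [mA A0 FA]] := Fnormal; exists A; split=> //.
  apply: subset_trans FA; apply: subsetC => x Fx x2 /=; have [Ft Fn] := Fx x2.
  have := circle_norm x; set t := Complex _ _ in Ft Fn * => t1.
  have : horner_mxE P t \is normalmx by rewrite PE //; exact: normalmxZ.
  rewrite (normal_circle t1 Pd) => /eqP/matrixP/(_ i j).
  by rewrite [LHS]mxE [RHS]mxE.
- move=> c; have [t t1 dt] := Fdeg c.
  apply: contraNneq (dt) => /(congr1 (horner^~ t)); rewrite horner0 horner_mxE_det.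
  have [Ft _] := Fan t t1; rewrite PE //.
  rewrite (_ : _ - _ = q.[t] *: (mx_eval F t - c%:M)); last first.
    by rewrite scalerBr scale_scalar_mx mulrC.
  move/eqP; rewrite detZ mulf_eq0 expf_eq0 => /orP[/andP[_ qt]|//].
  by have := q1 t (ltW t1); rewrite qt.
Qed.

End toeplitz_to_symbols.

Theorem theorem4 (R : realType) (H : hilbertType R) (m : nat)
    (V S : {linear H -> H}) (U : {linear H -> (disc R -> 'cV[R[i]]_m)}) :
  (0 < m)%N ->
  pure_isometry V ->
  codim (range V) m ->
  bounded_op S ->
  kolmogorov_wold V U ->
  ([/\ subnormal S, pure_op S, without_point_masses S, finite_type S &
       forall x, S (V x) = V (S x)]
   <->
   exists F : 'M[{fraction {poly R[i]}}]_m,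
     NDARN F /\ forall f, H2 R m f -> conj_op U S f = toeplitz F f).
Proof.
case: m U => // m U _ [isoV _] _ Sb KW.
have [coef [CO UC]] := kolmogorov_wold_coefficients KW.
have [B [e [u [VS BE eE]]]] := coefficients_vector_shift isoV CO.
have symP := has_symbolP KW UC eE; have toepP := toeplitzP KW S.
split=> [[_ _ nopm [_ _ rankS] SV]|[F [NF /toepP SF]]].
  have [d [q [P [NP /symP SP]]]] := subnormal_symbol VS Sb SV nopm rankS.
  exists (mxfrac q P); split; first exact: normal_symbol_NDARN NP.
  apply/toepP => x t; have qt := ns_unit NP (ltW (valP t)).
  by rewrite (mxfrac_eval P qt).2 -scalemxAl -SP scalerA mulVf // scale1r.
have SF' : has_symbol (T := V) (e := e) S (mxden F) (mxnum F).
  apply/symP => x t; have [[Fan _] _ _] := NF.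
  by rewrite SF mxnum_eval ?scalemxAl //; exact: (Fan _ (valP t)).1.
have [d [q [P [NP SP]]]] := NDARN_normal_symbol VS NF SF'.
have [W [W' [J [MW WK isoJ WJ [eJ noeig]]]]] := bilateral_shift CO VS BE eE.
exact: (symbol_subnormal VS MW WK isoJ WJ eJ noeig NP SP).
Qed.
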